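(* Let $\sigma,\tau\in\mathcal{W}_0$ with associated weight matrices $\mathcal{M}_\sigma=\{\mathbf{S}^{(\ell)}:\ell>0\}$ and $\mathcal{M}_\tau=\{\mathbf{T}^{(\ell)}:\ell>0\}$. Let $0<\alpha<2$, $\psi(x):=x^2+\frac14$ for $x\in\mathbb{R}$, $\mu\in\mathbb{C}$ with $|\mu|>1$, and set $R_\mu:=\sum_{m=0}^{+\infty}\frac{C_{\psi_m}}{\mu^{m+1}}$ (i.e. $R_\mu=(\mu-C_\psi)^{-1}$). Assume that (a) $\gamma(\sigma)>1$; (b) there exists $k_0>0$ such that $\mathbf{T}^{(k_0)}\preceq\mathbf{S}^{(\ell)}$ for all $\ell>0$. Then there exists $f\in\mathcal{S}_{(\sigma)}(\mathbb{R})$ such that $$R_\mu(f)\notin\mathcal{S}_{((((\tau^\iota)^\alpha)_\star)^{1/\alpha})}(\mathbb{R})=\mathcal{S}_{(\tau\check{\star}\,\mathrm{id}^{1/\alpha})}(\mathbb{R})=\mathcal{S}_{(\mathcal{M}_\tau\cdot\mathbf{G}^\alpha)}(\mathbb{R}).$$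
   Context: $\mathbb{N}=\{0,1,2,\dots\}$. $\mathcal{W}_0$ is the set of all continuous, non-decreasing $\omega:[0,+\infty)\to[0,+\infty)$ with $\omega(t)=0$ for $t\in[0,1]$, $\lim_{t\to+\infty}\omega(t)=+\infty$, $\log t=o(\omega(t))$ as $t\to+\infty$, and $\varphi_\omega:t\mapsto\omega(e^t)$ convex on $\mathbb{R}$. Associated weight matrix: $\varphi^*_\omega(x):=\sup_{y\ge0}\{xy-\varphi_\omega(y)\}$, $x\ge0$, and $\mathcal{M}_\omega:=\{\mathbf{W}^{(\ell)}:\ell>0\}$ with $W^{(\ell)}_p:=\exp(\frac1\ell\varphi^*_\omega(\ell p))$. Growth index: for non-decreasing $\omega:[0,+\infty)\to[0,+\infty)$ tending to $+\infty$, $\gamma(\omega)$ is the supremum of all $\gamma>0$ such that there is $K>1$ with $\limsup_{t\to+\infty}\omega(K^\gamma t)/\omega(t)<K$ (and $\gamma(\omega):=0$ if there is no such $\gamma$). $\mathbf{M}\preceq\mathbf{N}$ means $\sup_{p\ge1}(M_p/N_p)^{1/p}<+\infty$. $\mathbf{G}^\alpha:=(p!^\alpha)_p$ and $\mathcal{M}_\tau\cdot\mathbf{G}^\alpha:=\{(T^{(\ell)}_pp!^\alpha)_p:\ell>0\}$. Conjugates: $\sigma\check{\star}\tau(t):=\inf_{s>0}\{\sigma(s)+\tau(t/s)\}$; $\mathrm{id}^{1/\alpha}(t):=t^{1/\alpha}$; $h^\iota(t):=h(1/t)$, $h^\beta(t):=h(t^\beta)$ for $\beta>0$, $h_\star(t):=\inf_{u>0}\{h(u)+tu\}$,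 so $(((\tau^\iota)^\alpha)_\star)^{1/\alpha}(t)=\inf_{u>0}\{\tau(u^{-\alpha})+t^{1/\alpha}u\}$. Spaces: for a non-decreasing $\omega:[0,+\infty)\to[0,+\infty)$ with $\log t=o(\omega(t))$, $$\mathcal{S}_{(\omega)}(\mathbb{R}):=\Big\{f\in C^\infty(\mathbb{R}):\ \sup_{x\in\mathbb{R},\,j,k\in\mathbb{N}}\frac{(1+|x|)^k|f^{(j)}(x)|}{W^{(\ell)}_{j+k}}<+\infty\ \ \forall\,\ell>0\Big\},$$ where $W^{(\ell)}_p=\exp(\frac1\ell\varphi^*_\omega(\ell p))$ and, if $\omega$ is not zero on $[0,1]$, $\varphi^*_\omega(x):=\sup_{y\in\mathbb{R}}\{xy-\omega(e^y)\}$. For a family $\mathcal{M}=\{\mathbf{M}^{(\ell)}:\ell>0\}$ of positive sequences, $$\mathcal{S}_{(\mathcal{M})}(\mathbb{R}):=\Big\{f\in C^\infty(\mathbb{R}):\ \sup_{x\in\mathbb{R},\,j,k\in\mathbb{N}}\frac{(1+|x|)^k|f^{(j)}(x)|}{h^{j+k}M^{(\ell)}_{j+k}}<+\infty\ \ \forall\,\ell,h>0\Big\}.$$ Composition operators: $C_\psi f:=f\circ\psi$; $\psi_m$ is the $m$-fold iterate of $\psi$ ($\psi_0=\mathrm{id}$), so $R_\mu f=\sum_{m\ge0}\mu^{-m-1}\,f\circ\psi_m$. *)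

(* Defs.v *)
From Stdlib Require Import Reals Factorial.
From Coquelicot Require Import Coquelicot.
Open Scope R_scope.

(* Functions on [0,+oo) are represented by functions R -> R whose values on
   negative arguments are irrelevant. *)

Definition nonneg_on_half_line (w : R -> R) : Prop :=
  forall t, 0 <= t -> 0 <= w t.

Definition nondecreasing_on_half_line (w : R -> R) : Prop :=
  forall s t, 0 <= s -> s <= t -> w s <= w t.

Definition convex_fun (f : R -> R) : Prop :=
  forall x y a, 0 <= a <= 1 ->
    f (a * x + (1 - a) * y) <= a * f x + (1 - a) * f y.

Definition phi (w : R -> R) (t : R) : R := w (exp t).

Definition zero_on_unit_interval (w : R -> R) : Prop :=
  forall t, 0 <= t <= 1 -> w t = 0.

(* [is_domin F f g] reads g = o(f) along F. *)
Record W0 (w : R -> R) : Prop := {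
  W0_nonneg : nonneg_on_half_line w;
  W0_continuous : continuous_on (fun t => 0 <= t) w;
  W0_nondecreasing : nondecreasing_on_half_line w;
  W0_zero : zero_on_unit_interval w;
  W0_lim : is_lim w p_infty p_infty;
  W0_log : is_domin (Rbar_locally p_infty) w ln;
  W0_convex : convex_fun (phi w)
}.

(* sup over y >= 0 if w vanishes on [0,1], and sup over all real y otherwise.
   The supremum is finite for x >= 0 whenever w is nonnegative, nondecreasing
   and log t = o(w(t)). *)
Definition phi_conj (w : R -> R) (x : R) : R :=
  real (Lub_Rbar (fun z => exists y,
    (zero_on_unit_interval w -> 0 <= y) /\ z = x * y - phi w y)).

Definition weight_seq (w : R -> R) (l : R) (p : nat) : R :=
  exp (/ l * phi_conj w (l * INR p)).

(* limsup_{t -> +oo} f t = inf_T sup_{t >= T} f t. *)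
Definition limsup_pinfty (f : R -> R) : Rbar :=
  Rbar_glb (fun s => exists T, s = Lub_Rbar (fun y => exists t, T <= t /\ y = f t)).

Definition growth_admissible (w : R -> R) (g : R) : Prop :=
  0 < g /\
  exists K, 1 < K /\ Rbar_lt (limsup_pinfty (fun t => w (Rpower K g * t) / w t)) K.

(* All admissible g are positive, so adjoining 0 to the set only implements the
   convention that the index is 0 when no g is admissible. *)
Definition growth_index (w : R -> R) : Rbar :=
  Lub_Rbar (fun g => g = 0 \/ growth_admissible w g).

Definition preceq_seq (M N : nat -> R) : Prop :=
  bound (fun r => exists p : nat, (1 <= p)%nat /\ r = Rpower (M p / N p) (/ INR p)).

(* A family of sequences; only the indices l > 0 matter. *)
Definition weight_family := R -> nat -> R.

Definition mul_gevrey (T : weight_family) (a : R) : weight_family :=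
  fun l p => T l p * Rpower (INR (fact p)) a.

(* t^b for t >= 0 and b > 0; [Rpower 0 b] is not 0. *)
Definition rpow (t b : R) : R := if Rle_dec t 0 then 0 else Rpower t b.

Definition check_star (s t : R -> R) (x : R) : R :=
  real (Glb_Rbar (fun z => exists u, 0 < u /\ z = s u + t (x / u))).

Definition id_pow (b : R) (t : R) : R := rpow t b.

Definition inv_arg (h : R -> R) (t : R) : R := h (1 / t).

Definition pow_arg (h : R -> R) (b : R) (t : R) : R := h (rpow t b).

Definition lower_star (h : R -> R) (t : R) : R :=
  real (Glb_Rbar (fun z => exists u, 0 < u /\ z = h u + t * u)).

(* Derivatives of complex-valued functions of a real variable are taken
   componentwise. *)
Definition smooth (f : R -> C) : Prop :=
  forall (n : nat) (x : R),
    ex_derive_n (fun t => Re (f t)) n x /\ ex_derive_n (fun t => Im (f t)) n x.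

Definition CDerive_n (f : R -> C) (n : nat) (x : R) : C :=
  (Derive_n (fun t => Re (f t)) n x, Derive_n (fun t => Im (f t)) n x).

Definition S_weight (w : R -> R) (f : R -> C) : Prop :=
  smooth f /\
  forall l, 0 < l ->
    bound (fun r => exists (x : R) (j k : nat),
      r = (1 + Rabs x) ^ k * Cmod (CDerive_n f j x) / weight_seq w l (j + k)).

Definition S_family (M : weight_family) (f : R -> C) : Prop :=
  smooth f /\
  forall l h, 0 < l -> 0 < h ->
    bound (fun r => exists (x : R) (j k : nat),
      r = (1 + Rabs x) ^ k * Cmod (CDerive_n f j x) / (h ^ (j + k) * M l (j + k)%nat)).

Definition psi (x : R) : R := x ^ 2 + 1 / 4.

(* [is_resolvent mu q f g]: the series sum_m mu^(-m-1) f o q_m, with q_m the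
   m-fold iterate of q, converges pointwise with sum g, i.e. R_mu f = g. *)
Definition is_resolvent (mu : C) (q : R -> R) (f g : R -> C) : Prop :=
  forall x : R,
    is_series (fun m : nat => (f (Nat.iter m q x) / mu ^ (S m))%C) (g x).

(* Main.v *)
Require Import Defs.
From Stdlib Require Import Reals Factorial Lra Lia.
From Stdlib Require Import FunctionalExtensionality ClassicalEpsilon Classical.
From Coquelicot Require Import Coquelicot.
Open Scope R_scope.

(* 1/2 is a parabolic fixed point of psi. The backward orbit x_m of 1 tends to it
   like 1/m, so psi_m'(x_m) >= m^2/12. Let f be supported in (19/20, 21/20), which
   is disjoint from its images under the iterates of psi: near x_m the series R_mu f
   reduces to the term f o psi_m / mu^(m+1). Its n-th derivative at x_n, with m = n,
   contains f^(n)(1) psi_n'(x_n)^n, which exceeds |f^(n)(1)| by a factor of order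
   n!^2 up to geometric factors, and n!^2 beats n!^alpha.

   The function f is a signed sum of w_k sin^k (N_k (x - 1) / k) chi(x). The k-th
   atom vanishes to order k at 1, so the n-th derivative involves only the atoms
   with k <= n, and the signs can be chosen inductively so that the leading one is
   not cancelled. As its frequencies are at most N_k, the j-th derivative of
   w_k sin^k (N_k (x - 1) / k) is at most w_k N_k^j; taking for (w_k, N_k) a
   supporting line of log V, where V_n = T_n / n!^eps + n!, this is at most V_j, with
   equality at j = k for infinitely many k. The condition gamma(sigma) > 1 gives
   sigma(t) = O(t^b) with b < 1, which makes room for the cutoff chi of Gevrey order
   below 1/b and for the factorial in V.

   The weight of the second space has conjugate
   phi*_tau(x) + alpha x log (alpha x) - alpha x, so its sequences are
   T^(l)_p (alpha l / e)^(alpha p) p^(alpha p); the factor l^(alpha p) absorbs the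
   geometric factors h^p of the third space. *)

(** * Derivative families, products and series *)

(** A smooth function carried together with all its derivatives: estimates are proved for explicit
    families [F n] and transferred to [Derive_n] only at the end. *)
Definition jet (F : nat -> R -> R) : Prop :=
  forall n x, is_derive (F n) x (F (S n) x).

Lemma jet_Derive_n (F : nat -> R -> R) :
  jet F -> forall n x, Derive_n (F 0%nat) n x = F n x.
Proof.
  intros HF n; induction n as [|n IH]; intros x; [reflexivity|].
  simpl. rewrite (Derive_ext _ _ x IH). apply is_derive_unique, HF.
Qed.

Lemma jet_ex_derive_n (F : nat -> R -> R) :
  jet F -> forall n x, ex_derive_n (F 0%nat) n x.
Proof.
  intros HF [|n] x; [exact I|].
  simpl. apply ex_derive_ext with (F n).
  - intros t; symmetry; now apply jet_Derive_n.
  - eexists; apply HF.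
Qed.

(** A quadratic remainder can be summed over a series and can be checked directly at a flat point;
    both uses occur below. *)
Lemma is_derive_quadratic (F : R -> R) (x d C : R) :
  (forall h, Rabs (F (x + h) - F x - h * d) <= C * h ^ 2) -> is_derive F x d.
Proof.
  intros H. apply is_derive_Reals. intros eps Heps.
  assert (HC : 0 < Rabs C + 1) by (pose proof (Rabs_pos C); lra).
  assert (Hd : 0 < eps / (Rabs C + 1)) by (apply Rdiv_lt_0_compat; lra).
  exists (mkposreal _ Hd). intros h Hh Hlt. simpl in Hlt.
  replace ((F (x + h) - F x) / h - d) with ((F (x + h) - F x - h * d) / h)
    by (field; assumption).
  unfold Rdiv. rewrite Rabs_mult, Rabs_inv.
  assert (Hh' : 0 < Rabs h) by now apply Rabs_pos_lt.
  apply Rmult_lt_reg_r with (Rabs h); [assumption|].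
  rewrite Rmult_assoc, Rinv_l, Rmult_1_r by lra.
  apply Rle_lt_trans with (Rabs C * Rabs h * Rabs h).
  - eapply Rle_trans; [apply H|].
    rewrite Rmult_assoc, <- Rabs_mult.
    replace (h * h) with (h ^ 2) by ring.
    rewrite (Rabs_pos_eq (h ^ 2)) by apply pow2_ge_0.
    apply Rmult_le_compat_r; [apply pow2_ge_0 | apply Rle_abs].
  - apply Rmult_lt_compat_r; [assumption|].
    apply Rmult_lt_reg_r with (/ (Rabs C + 1)); [now apply Rinv_0_lt_compat|].
    apply Rle_lt_trans with (Rabs h); [|exact Hlt].
    apply Rmult_le_reg_r with (Rabs C + 1); [assumption|].
    rewrite Rmult_assoc, Rinv_l, Rmult_1_r by lra.
    nra.
Qed.

Lemma taylor2_bound (F0 F1 F2 : R -> R) (M : R) :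
  (forall x, is_derive F0 x (F1 x)) -> (forall x, is_derive F1 x (F2 x)) ->
  (forall x, Rabs (F2 x) <= M) ->
  forall x h, Rabs (F0 (x + h) - F0 x - h * F1 x) <= M * h ^ 2.
Proof.
  intros H0 H1 HM x h.
  assert (HL : forall a b, Rabs (F1 b - F1 a) <= M * Rabs (b - a)).
  { intros a b.
    destruct (MVT_gen F1 a b F2) as [c [_ Hc]].
    - intros; apply H1.
    - intros c _. apply continuity_pt_filterlim.
      apply (ex_derive_continuous F1). eexists; apply H1.
    - rewrite Hc, Rabs_mult. apply Rmult_le_compat_r; [apply Rabs_pos|apply HM]. }
  destruct (MVT_gen F0 x (x + h) F1) as [c [Hcin Hc]].
  - intros; apply H0.
  - intros c _. apply continuity_pt_filterlim.
    apply (ex_derive_continuous F0). eexists; apply H0.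
  - rewrite Hc.
    replace (F1 c * (x + h - x) - h * F1 x) with (h * (F1 c - F1 x)) by ring.
    rewrite Rabs_mult.
    assert (Rabs (c - x) <= Rabs h).
    { revert Hcin. unfold Rmin, Rmax. destruct (Rle_dec x (x + h)); intros.
      - rewrite !Rabs_pos_eq; lra.
      - rewrite !Rabs_left1; lra. }
    assert (0 <= M) by (eapply Rle_trans; [apply Rabs_pos|apply (HM x)]).
    specialize (HL x c).
    replace (M * h ^ 2) with (Rabs h * (M * Rabs h)).
    + apply Rmult_le_compat_l; [apply Rabs_pos|].
      eapply Rle_trans; [exact HL|]. now apply Rmult_le_compat_l.
    + replace (h ^ 2) with (Rabs h ^ 2) by apply pow2_abs. ring.
Qed.

(* The n-th derivative of [F p * G q]; carrying both indices avoids the binomial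
   formula. *)
Fixpoint jet_mul (F G : nat -> R -> R) (n p q : nat) (x : R) : R :=
  match n with
  | O => F p x * G q x
  | S n => jet_mul F G n (S p) q x + jet_mul F G n p (S q) x
  end.

Lemma jet_mul_derive (F G : nat -> R -> R) :
  jet F -> jet G ->
  forall n p q x, is_derive (jet_mul F G n p q) x (jet_mul F G (S n) p q x).
Proof.
  intros HF HG n; induction n as [|n IH]; intros p q x.
  - exact (is_derive_mult (F p) (G q) x _ _ (HF p x) (HG q x) Rmult_comm).
  - apply (is_derive_plus (jet_mul F G n (S p) q) (jet_mul F G n p (S q))); apply IH.
Qed.

Lemma jet_jet_mul (F G : nat -> R -> R) :
  jet F -> jet G -> jet (fun n => jet_mul F G n 0 0).
Proof. intros HF HG n x. now apply jet_mul_derive. Qed.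

(** Unfolding [n] differentiations produces [2 ^ n] products [F i * G j], all of the same total
    order [N]. *)
Lemma jet_mul_bound (F G : nat -> R -> R) (x U : R) (N : nat) :
  (forall i j, (i + j = N)%nat -> Rabs (F i x) * Rabs (G j x) <= U) ->
  forall n p q, (n + p + q = N)%nat -> Rabs (jet_mul F G n p q x) <= 2 ^ n * U.
Proof.
  intros H n; induction n as [|n IH]; intros p q Hn; simpl.
  - rewrite Rabs_mult, Rmult_1_l. apply H. lia.
  - eapply Rle_trans; [apply Rabs_triang|].
    assert (H1 : Rabs (jet_mul F G n (S p) q x) <= 2 ^ n * U) by (apply IH; lia).
    assert (H2 : Rabs (jet_mul F G n p (S q) x) <= 2 ^ n * U) by (apply IH; lia).
    lra.
Qed.

Lemma jet_mul_zero (F G : nat -> R -> R) (x : R) (k : nat) :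
  (forall j, (j < k)%nat -> F j x = 0) ->
  forall n p q, (n + p < k)%nat -> jet_mul F G n p q x = 0.
Proof.
  intros H n; induction n as [|n IH]; intros p q Hn; simpl.
  - rewrite H by lia. ring.
  - rewrite !IH by lia. ring.
Qed.

(** Since [F] vanishes to order [k] at [x], only the product in which every derivative falls on [F]
    survives. *)
Lemma jet_mul_leading (F G : nat -> R -> R) (x : R) (k : nat) :
  (forall j, (j < k)%nat -> F j x = 0) ->
  forall n p q, (n + p = k)%nat -> jet_mul F G n p q x = F k x * G q x.
Proof.
  intros H n; induction n as [|n IH]; intros p q Hn; simpl.
  - now replace p with k by lia.
  - rewrite IH by lia. rewrite (jet_mul_zero _ _ _ _ H) by lia. ring.
Qed.

(** * Derivatives of products of powers of sine and cosine *)

Fixpoint sincos_jet (b y : R) (n p q : nat) (x : R) : R :=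
  match n with
  | O => sin (b * (x - y)) ^ p * cos (b * (x - y)) ^ q
  | S n => b * (INR p * sincos_jet b y n (pred p) (S q) x
                - INR q * sincos_jet b y n (S p) (pred q) x)
  end.

Lemma sincos_jet_derive (b y : R) (n p q : nat) (x : R) :
  is_derive (sincos_jet b y n p q) x (sincos_jet b y (S n) p q x).
Proof.
  revert p q x; induction n as [|n IH]; intros p q x.
  - simpl. auto_derive; [exact I|]. unfold Rminus. ring.
  - change (is_derive (fun x => b * (INR p * sincos_jet b y n (pred p) (S q) x
                - INR q * sincos_jet b y n (S p) (pred q) x)) x
      (b * (INR p * sincos_jet b y (S n) (pred p) (S q) x
                - INR q * sincos_jet b y (S n) (S p) (pred q) x))).
    apply (is_derive_scal (fun x => _ - _)).
    apply (is_derive_minus (fun x => _ * _) (fun x => _ * _));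
      apply is_derive_scal; apply IH.
Qed.

(** Each differentiation exchanges one sine for a cosine or conversely, so the degree [p + q] is
    kept and the coefficients add up to [b * (p + q)]. With [b = N / k], [p = k] and [q = 0] the
    bound becomes [N ^ n]. *)
Lemma sincos_jet_bound (b y : R) (n p q : nat) (x : R) :
  0 <= b -> Rabs (sincos_jet b y n p q x) <= (b * INR (p + q)) ^ n.
Proof.
  intros Hb. revert p q; induction n as [|n IH]; intros p q.
  - simpl. rewrite Rabs_mult, <- !RPow_abs.
    rewrite <- (Rmult_1_l 1).
    apply Rmult_le_compat; try (apply pow_le, Rabs_pos).
    + rewrite <- (pow1 p). apply pow_incr. split; [apply Rabs_pos|].
      apply Rabs_le, SIN_bound.
    + rewrite <- (pow1 q). apply pow_incr. split; [apply Rabs_pos|].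
      apply Rabs_le, COS_bound.
  - assert (HA : Rabs (INR p * sincos_jet b y n (pred p) (S q) x)
                 <= INR p * (b * INR (p + q)) ^ n).
    { rewrite Rabs_mult, (Rabs_pos_eq (INR p)) by apply pos_INR.
      (* For [p = 0] the truncated predecessor would change the degree, but the coefficient [INR p]
         is then zero. *)
      destruct p as [|p]; [simpl; lra|].
      apply Rmult_le_compat_l; [apply pos_INR|].
      replace (S p + q)%nat with (pred (S p) + S q)%nat by lia. apply IH. }
    assert (HB : Rabs (INR q * sincos_jet b y n (S p) (pred q) x)
                 <= INR q * (b * INR (p + q)) ^ n).
    { rewrite Rabs_mult, (Rabs_pos_eq (INR q)) by apply pos_INR.
      destruct q as [|q]; [simpl; lra|].
      apply Rmult_le_compat_l; [apply pos_INR|].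
      replace (p + S q)%nat with (S p + pred (S q))%nat by lia. apply IH. }
    simpl sincos_jet. rewrite Rabs_mult, (Rabs_pos_eq b) by assumption.
    replace ((b * INR (p + q)) ^ S n) with
      (b * (INR p * (b * INR (p + q)) ^ n + INR q * (b * INR (p + q)) ^ n))
      by (rewrite plus_INR; simpl; ring).
    apply Rmult_le_compat_l; [assumption|].
    eapply Rle_trans; [apply Rabs_triang|]. rewrite Rabs_Ropp. lra.
Qed.

(** A differentiation removes at most one sine, so a factor vanishing at [y] remains as long as
    [n < p]. *)
Lemma sincos_jet_zero (b y : R) (n p q : nat) :
  (n < p)%nat -> sincos_jet b y n p q y = 0.
Proof.
  revert p q; induction n as [|n IH]; intros p q Hn; simpl.
  - rewrite Rminus_diag, Rmult_0_r, sin_0, pow_i by lia. ring.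
  - rewrite !IH by lia. ring.
Qed.

Lemma sincos_jet_leading (b y : R) (n q : nat) :
  sincos_jet b y n n q y = INR (fact n) * b ^ n.
Proof.
  revert q; induction n as [|n IH]; intros q.
  - simpl. rewrite Rminus_diag, Rmult_0_r, cos_0, pow1. ring.
  - cbn [sincos_jet pred]. rewrite IH, sincos_jet_zero by lia.
    change (fact (S n)) with (S n * fact n)%nat. rewrite mult_INR. simpl pow. ring.
Qed.

(** * Termwise differentiation of dominated series *)

Definition lincomb (u : nat -> nat -> R -> R) (c : nat -> R) (j : nat) (x : R) : R :=
  Series (fun k => c k * u k j x).

Lemma ex_series_half : ex_series (fun n => (/ 2) ^ n).
Proof. apply ex_series_geom. rewrite Rabs_pos_eq; lra. Qed.

Definition lincomb_dominated (u : nat -> nat -> R -> R) (c M : nat -> R) : Prop :=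
  forall k j x, Rabs (c k * u k j x) <= M j * (/ 2) ^ k.

Lemma lincomb_ex_abs (u : nat -> nat -> R -> R) (c M : nat -> R) (j : nat) (x : R) :
  lincomb_dominated u c M -> ex_series (fun k => Rabs (c k * u k j x)).
Proof.
  intros Hb. apply (ex_series_le (fun k => Rabs (c k * u k j x)) (fun k => M j * (/ 2) ^ k)).
  - intros k. unfold norm; simpl. unfold abs; simpl. rewrite Rabs_Rabsolu. apply Hb.
  - apply (ex_series_scal_l (M j) (fun k => (/ 2) ^ k)), ex_series_half.
Qed.

Lemma lincomb_ex (u : nat -> nat -> R -> R) (c M : nat -> R) (j : nat) (x : R) :
  lincomb_dominated u c M -> ex_series (fun k => c k * u k j x).
Proof. intros Hb. apply ex_series_Rabs. exact (lincomb_ex_abs u c M j x Hb). Qed.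

Lemma lincomb_bound (u : nat -> nat -> R -> R) (c M : nat -> R) (j : nat) (x : R) :
  lincomb_dominated u c M -> Rabs (lincomb u c j x) <= 2 * M j.
Proof.
  intros Hb. unfold lincomb.
  eapply Rle_trans; [apply Series_Rabs; exact (lincomb_ex_abs u c M j x Hb)|].
  eapply Rle_trans.
  - apply (Series_le _ (fun k => M j * (/ 2) ^ k)).
    + intros k; split; [apply Rabs_pos|apply Hb].
    + apply (ex_series_scal_l (M j) (fun k => (/ 2) ^ k)), ex_series_half.
  - rewrite Series_scal_l, Series_geom by (rewrite Rabs_pos_eq; lra).
    apply Req_le. field.
Qed.

(** The bound on the derivatives of order [j + 2] controls the first-order Taylor remainder of each
    summand; these remainders add up to at most [2 * M (j + 2) * h ^ 2]. *)
Lemma lincomb_jet (u : nat -> nat -> R -> R) (c M : nat -> R) :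
  (forall k, jet (u k)) -> lincomb_dominated u c M -> jet (lincomb u c).
Proof.
  intros Hjet Hb j x. apply (is_derive_quadratic _ _ _ (2 * M (S (S j)))). intros h.
  unfold lincomb.
  rewrite <- Series_minus, <- Series_scal_l, <- Series_minus;
    try (apply (lincomb_ex u c M); exact Hb).
  2: { apply (ex_series_minus (fun k => c k * u k j (x+h))); apply (lincomb_ex u c M); exact Hb. }
  2: { apply (ex_series_scal_l h (fun k => c k * u k (S j) x)); apply (lincomb_ex u c M); exact Hb. }
  assert (HB : forall k, Rabs (c k * u k j (x + h) - c k * u k j x - h * (c k * u k (S j) x))
     <= M (S (S j)) * h ^ 2 * (/ 2) ^ k).
  { intros k.
    pose proof (taylor2_bound (fun x => c k * u k j x) (fun x => c k * u k (S j) x)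
       (fun x => c k * u k (S (S j)) x) (M (S (S j)) * (/ 2) ^ k)) as T.
    eapply Rle_trans; [apply T|]; intros.
    - apply is_derive_scal, Hjet.
    - apply is_derive_scal, Hjet.
    - apply Hb.
    - apply Req_le; ring. }
  assert (EX : ex_series (fun k => M (S (S j)) * h ^ 2 * (/ 2) ^ k))
    by (apply (ex_series_scal_l (M (S (S j)) * h ^ 2) (fun k => (/ 2) ^ k)), ex_series_half).
  eapply Rle_trans; [apply Series_Rabs|].
  - refine (ex_series_le (K := R_AbsRing) (V := R_CompleteNormedModule) _ _ _ EX).
    intros k. unfold norm; simpl. unfold abs; simpl. rewrite Rabs_Rabsolu. apply HB.
  - eapply Rle_trans.
    + apply (Series_le _ (fun k => M (S (S j)) * h ^ 2 * (/ 2) ^ k)); [|exact EX].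
      intros k; split; [apply Rabs_pos|apply HB].
    + rewrite Series_scal_l, Series_geom by (rewrite Rabs_pos_eq; lra).
      apply Req_le. field.
Qed.

(** * A Gevrey cutoff *)

(** The [n]-th derivative of [E_k(x) = x^(-k) exp(-x^(-a))], extended by 0 to [x <= 0]. The family
    is closed under differentiation: [E_k' = -k E_(k+1) + a E_(k+a+1)]. *)
Fixpoint bump_jet (a n k : nat) (x : R) : R :=
  match n with
  | O => if Rle_dec x 0 then 0 else (/ x) ^ k * exp (- (/ x) ^ a)
  | S n => - INR k * bump_jet a n (S k) x + INR a * bump_jet a n (k + a + 1) x
  end.

Lemma ln_le_sub_1 (x : R) : 0 < x -> ln x <= x - 1.
Proof. intros Hx. pose proof (exp_ineq1_le (ln x)). rewrite exp_ln in H; lra. Qed.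

Lemma ln_pow' (x : R) (n : nat) : 0 < x -> ln (x ^ n) = INR n * ln x.
Proof.
  intros Hx. rewrite <- Rpower_pow by assumption. apply ln_Rpower.
Qed.

(** With [s = z ^ a] and [r = k / a], the claim is [r ln s - s <= r ln L], which follows from
    [ln (s / L) <= s / L] and [r <= L]. A single [L] for all [k <= L] is what the induction on
    derivatives needs. *)
Lemma pow_mul_exp_bound (a k : nat) (z L : R) :
  (1 <= a)%nat -> 0 < z -> INR k <= L -> 0 < L ->
  z ^ k * exp (- z ^ a) <= Rpower L (INR k / INR a).
Proof.
  intros Ha Hz Hk HL.
  assert (Ha' : 1 <= INR a) by (change 1 with (INR 1); now apply le_INR).
  set (s := z ^ a). assert (Hs : 0 < s) by now apply pow_lt.
  rewrite <- (exp_ln (z ^ k)) by now apply pow_lt.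
  rewrite <- exp_plus. unfold Rpower.
  assert (E : ln (z ^ k) = INR k / INR a * ln s).
  { unfold s. rewrite !ln_pow' by assumption. field. lra. }
  rewrite E. set (r := INR k / INR a).
  assert (Hr : 0 <= r <= L).
  { unfold r; split.
    - apply Rmult_le_pos; [apply pos_INR|apply Rlt_le, Rinv_0_lt_compat; lra].
    - apply Rle_trans with (INR k); [|assumption].
      apply Rmult_le_reg_r with (INR a); [lra|].
      unfold Rdiv. rewrite Rmult_assoc, Rinv_l, Rmult_1_r by lra.
      pose proof (pos_INR k). nra. }
  assert (H : r * ln s - s <= r * ln L).
  { assert (Hq : 0 < s / L) by now apply Rdiv_lt_0_compat.
    pose proof (ln_le_sub_1 _ Hq) as H1. rewrite ln_div in H1 by assumption.
    assert (H2 : r * (ln s - ln L) <= r * (s / L)) by (apply Rmult_le_compat_l; lra).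
    assert (H3 : r * (s / L) <= s).
    { replace s with (L * (s / L)) at 2 by (field; lra).
      apply Rmult_le_compat_r; lra. }
    lra. }
  destruct (Rle_lt_or_eq_dec _ _ H) as [H'|H'].
  - apply Rlt_le, exp_increasing. lra.
  - apply Req_le. f_equal. lra.
Qed.

Lemma bump_jet_bound0 (a k : nat) (x L : R) :
  (1 <= a)%nat -> INR k <= L -> 0 < L ->
  0 <= bump_jet a 0 k x <= Rpower L (INR k / INR a).
Proof.
  intros Ha Hk HL. simpl. destruct (Rle_dec x 0) as [Hx|Hx].
  - split; [lra|]. apply Rlt_le, exp_pos.
  - assert (Hz : 0 < / x) by (apply Rinv_0_lt_compat; lra). split.
    + apply Rmult_le_pos; [now apply pow_le, Rlt_le|apply Rlt_le, exp_pos].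
    + now apply pow_mul_exp_bound.
Qed.

(* At 0 this uses [E_k h = h^2 E_(k+2) h] for [E_k x = x^-k exp (- x^-a)]. *)
Lemma bump_jet_derive0 (a k : nat) (x : R) :
  (1 <= a)%nat -> is_derive (bump_jet a 0 k) x (bump_jet a 1 k x).
Proof.
  intros Ha.
  destruct (Rtotal_order x 0) as [Hx|[Hx|Hx]].
  - apply is_derive_ext_loc with (fun _ => 0).
    + exists (mkposreal (- x) ltac:(lra)). intros y Hy.
      assert (Hy' : Rabs (y - x) < - x) by exact Hy. apply Rabs_lt_between in Hy'.
      simpl. destruct (Rle_dec y 0); lra.
    + replace (bump_jet a 1 k x) with 0; [apply @is_derive_const|].
      simpl. destruct (Rle_dec x 0); [ring|lra].
  - subst x. apply (is_derive_quadratic _ _ _ (Rpower (INR (k + 2)) (INR (k + 2) / INR a))).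
    intros h. rewrite Rplus_0_l.
    replace (bump_jet a 1 k 0) with 0.
    2: { simpl. destruct (Rle_dec 0 0); [ring|lra]. }
    replace (bump_jet a 0 k 0) with 0.
    2: { simpl. destruct (Rle_dec 0 0); [ring|lra]. }
    rewrite Rmult_0_r, !Rminus_0_r.
    assert (E : bump_jet a 0 k h = bump_jet a 0 (k + 2) h * h ^ 2).
    { simpl. destruct (Rle_dec h 0); [ring|]. rewrite pow_add. simpl. field. lra. }
    rewrite E, Rabs_mult, (Rabs_pos_eq (h ^ 2)) by apply pow2_ge_0.
    apply Rmult_le_compat_r; [apply pow2_ge_0|].
    destruct (bump_jet_bound0 a (k + 2) h (INR (k + 2)) Ha) as [H1 H2].
    + lra.
    + apply lt_0_INR; lia.
    + now rewrite Rabs_pos_eq.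
  - apply is_derive_ext_loc with (fun x => (/ x) ^ k * exp (- (/ x) ^ a)).
    + exists (mkposreal x Hx). intros y Hy.
      assert (Hy' : Rabs (y - x) < x) by exact Hy. apply Rabs_lt_between in Hy'.
      simpl. destruct (Rle_dec y 0); lra.
    + simpl. destruct (Rle_dec x 0); [lra|].
      auto_derive; [lra|].
      rewrite !pow_add. set (G := exp _).
      replace (INR k * (/ x) ^ pred k) with (INR k * (/ x) ^ k * x).
      2: { destruct k as [|k]; simpl pred; [simpl; ring|simpl pow; field; lra]. }
      replace (INR a * (/ x) ^ pred a) with (INR a * (/ x) ^ a * x).
      2: { destruct a as [|a]; simpl pred; [lia|simpl pow; field; lra]. }
      simpl (_ ^ 1). field. lra.
Qed.

Lemma bump_jet_derive (a n k : nat) (x : R) :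
  (1 <= a)%nat -> is_derive (bump_jet a n k) x (bump_jet a (S n) k x).
Proof.
  intros Ha. revert k x; induction n as [|n IH]; intros k x.
  - now apply bump_jet_derive0.
  - change (is_derive
      (fun x => - INR k * bump_jet a n (S k) x + INR a * bump_jet a n (k + a + 1) x) x
      (- INR k * bump_jet a (S n) (S k) x + INR a * bump_jet a (S n) (k + a + 1) x)).
    apply (is_derive_plus (fun x => _ * _) (fun x => _ * _));
      apply is_derive_scal; apply IH.
Qed.

(** [L] dominates every exponent reached in [n] differentiations. The first term of the recursion
    costs a coefficient at most [L]; the second costs [a] and raises the exponent by [a] more, which
    is again a factor [L]. Each differentiation thus costs [(1 + a) L] times [L ^ (1 / a)]: Gevrey
    order [1 + 1 / a]. *)
Lemma bump_jet_bound (a n k : nat) (x L : R) :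
  (1 <= a)%nat -> 1 <= L -> INR (k + n * (a + 1)) <= L ->
  Rabs (bump_jet a n k x) <= (1 + INR a) ^ n * L ^ n * Rpower L (INR (k + n) / INR a).
Proof.
  intros Ha HL. assert (Ha' : 0 < INR a) by (apply lt_0_INR; lia).
  revert k; induction n as [|n IH]; intros k Hk.
  - rewrite Nat.mul_0_l, Nat.add_0_r in Hk.
    destruct (bump_jet_bound0 a k x L) as [H1 H2]; try assumption; [lra|].
    rewrite Rabs_pos_eq by assumption. rewrite Nat.add_0_r. simpl pow. lra.
  - cbn [bump_jet].
    assert (HkL : INR k <= L).
    { eapply Rle_trans; [|exact Hk]. apply le_INR. lia. }
    eapply Rle_trans; [apply Rabs_triang|].
    rewrite !Rabs_mult, Rabs_Ropp, !(Rabs_pos_eq (INR _)) by apply pos_INR.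
    assert (H1 := IH (S k)). assert (H2 := IH (k + a + 1)%nat).
    replace (INR (k + S n)) with (INR k + INR n + 1)
      by (rewrite plus_INR, S_INR; ring).
    replace (INR (S k + n)) with (INR k + INR n + 1) in H1
      by (rewrite plus_INR, S_INR; ring).
    replace (INR (k + a + 1 + n) / INR a) with ((INR k + INR n + 1) / INR a + 1) in H2
      by (rewrite !plus_INR; simpl INR; field; lra).
    rewrite Rpower_plus, Rpower_1 in H2 by lra.
    set (P := Rpower L ((INR k + INR n + 1) / INR a)) in *.
    assert (HP : 0 < P) by apply exp_pos.
    set (Q := (1 + INR a) ^ n * L ^ n) in *.
    assert (HQ : 0 < Q) by (apply Rmult_lt_0_compat; apply pow_lt; lra).
    assert (HQP : 0 < Q * P) by now apply Rmult_lt_0_compat.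
    replace ((1 + INR a) ^ S n * L ^ S n * P) with ((1 + INR a) * L * (Q * P))
      by (unfold Q; simpl; ring).
    assert (H1' : Rabs (bump_jet a n (S k) x) <= Q * P).
    { apply H1. eapply Rle_trans; [|exact Hk]. apply le_INR. lia. }
    assert (H2' : Rabs (bump_jet a n (k + a + 1) x) <= Q * (P * L)).
    { apply H2. eapply Rle_trans; [|exact Hk]. apply le_INR. lia. }
    assert (INR k * Rabs (bump_jet a n (S k) x) <= L * (Q * P)).
    { apply Rmult_le_compat; try apply pos_INR; try apply Rabs_pos; assumption. }
    assert (INR a * Rabs (bump_jet a n (k + a + 1) x) <= INR a * (Q * (P * L))).
    { apply Rmult_le_compat_l; [lra|assumption]. }
    lra.
Qed.

Definition bumpl_jet (a : nat) (n : nat) (x : R) : R := bump_jet a n 0 (x - 19 / 20).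
Definition bumpr_jet (a : nat) (n : nat) (x : R) : R :=
  (-1) ^ n * bump_jet a n 0 (21 / 20 - x).

Lemma jet_bumpl (a : nat) : (1 <= a)%nat -> jet (bumpl_jet a).
Proof.
  intros Ha n x. unfold bumpl_jet.
  pose proof (is_derive_comp (bump_jet a n 0) (fun x => x - 19 / 20) x _ 1
    (bump_jet_derive a n 0 (x - 19 / 20) Ha)) as H.
  replace (bump_jet a (S n) 0 (x - 19 / 20)) with
    (scal 1 (bump_jet a (S n) 0 (x - 19 / 20))) by (apply Rmult_1_l).
  apply H. auto_derive; [exact I|ring].
Qed.

Lemma jet_bumpr (a : nat) : (1 <= a)%nat -> jet (bumpr_jet a).
Proof.
  intros Ha n x. unfold bumpr_jet.
  pose proof (is_derive_comp (bump_jet a n 0) (fun x => 21 / 20 - x) x _ (-1)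
    (bump_jet_derive a n 0 (21 / 20 - x) Ha)) as H.
  replace ((-1) ^ S n * bump_jet a (S n) 0 (21 / 20 - x)) with
    ((-1) ^ n * scal (-1) (bump_jet a (S n) 0 (21 / 20 - x)))
    by (unfold scal; simpl; unfold mult; simpl; ring).
  apply is_derive_scal. apply H. auto_derive; [exact I|ring].
Qed.

Definition cutoff_jet (a : nat) (n : nat) (x : R) : R :=
  jet_mul (bumpl_jet a) (bumpr_jet a) n 0 0 x.

Lemma jet_cutoff (a : nat) : (1 <= a)%nat -> jet (cutoff_jet a).
Proof.
  intros Ha. apply jet_jet_mul; [now apply jet_bumpl|now apply jet_bumpr].
Qed.

Lemma cutoff_support (a : nat) (x : R) :
  x <= 19 / 20 \/ 21 / 20 <= x -> cutoff_jet a 0 x = 0.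
Proof.
  intros H. unfold cutoff_jet, jet_mul, bumpl_jet, bumpr_jet; simpl.
  destruct (Rle_dec (x - 19 / 20) 0), (Rle_dec (21 / 20 - x) 0); try ring; lra.
Qed.

Lemma cutoff_1_pos (a : nat) : 0 < cutoff_jet a 0 1.
Proof.
  unfold cutoff_jet, jet_mul, bumpl_jet, bumpr_jet; simpl.
  destruct (Rle_dec (1 - 19 / 20) 0), (Rle_dec (21 / 20 - 1) 0); try lra.
  rewrite !Rmult_1_l. apply Rmult_lt_0_compat; apply exp_pos.
Qed.

Lemma cutoff_bound (a : nat) :
  (1 <= a)%nat ->
  exists B, 0 < B /\ forall n x,
    Rabs (cutoff_jet a n x) <= B ^ n * Rpower (INR n) ((1 + / INR a) * INR n).
Proof.
  intros Ha. assert (Ha' : 0 < INR a) by (apply lt_0_INR; lia).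
  set (c := 1 + INR a). assert (Hc : 1 < c) by (unfold c; lra).
  set (e := 1 + / INR a).
  assert (Hai : 0 < / INR a) by now apply Rinv_0_lt_compat.
  exists (2 * c * Rpower c e). split.
  { repeat apply Rmult_lt_0_compat; try lra. apply exp_pos. }
  intros n x.
  destruct n as [|n].
  (* The order 0 stands apart: the value of [L] chosen below would be 0, while [bump_jet_bound]
     requires [1 <= L]. *)
  { unfold cutoff_jet, jet_mul, bumpl_jet, bumpr_jet. rewrite Rabs_mult.
    simpl INR. rewrite Rmult_0_r. unfold Rpower. rewrite Rmult_0_l, exp_0.
    replace ((2 * c * exp (e * ln c)) ^ 0 * 1) with (1 * 1) by (simpl; ring).
    assert (HB : forall x, Rabs (bump_jet a 0 0 x) <= 1).
    { intros y. destruct (bump_jet_bound0 a 0 y 1 Ha) as [H1 H2]; simpl INR; try lra.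
      rewrite Rabs_pos_eq by assumption. revert H2. unfold Rpower.
      rewrite ln_1, Rmult_0_r, exp_0. tauto. }
    apply Rmult_le_compat; try apply Rabs_pos; [apply HB|].
    rewrite Rabs_mult. simpl pow. rewrite Rabs_R1, Rmult_1_l. apply HB. }
  set (m := S n). assert (Hm : 1 <= INR m) by (change 1 with (INR 1); apply le_INR; lia).
  (* At most [m] differentiations starting from exponent 0 reach exponent [m * (a + 1)], which is
     this [L]. *)
  set (L := c * INR m).
  assert (HL : 1 <= L) by (unfold L; nra).
  assert (HJ : forall i y, (i <= m)%nat ->
    Rabs (bump_jet a i 0 y) <= c ^ i * Rpower L (e * INR i)).
  { intros i y Hi.
    eapply Rle_trans; [apply (bump_jet_bound a i 0 y L Ha HL)|].
    - unfold L, c. rewrite Nat.add_0_l, mult_INR, plus_INR. simpl (INR 1).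
      apply le_INR in Hi. pose proof (pos_INR i). nra.
    - apply Req_le. rewrite Nat.add_0_l, Rmult_assoc. f_equal.
      rewrite <- Rpower_pow, <- Rpower_plus by lra. f_equal. unfold e. field. lra. }
  unfold cutoff_jet.
  eapply Rle_trans.
  - apply (jet_mul_bound _ _ x (c ^ m * Rpower L (e * INR m)) m); [|lia].
    intros i j Hij. unfold bumpl_jet, bumpr_jet.
    rewrite (Rabs_mult ((-1) ^ j)), pow_1_abs, Rmult_1_l.
    replace (c ^ m * Rpower L (e * INR m)) with
      ((c ^ i * Rpower L (e * INR i)) * (c ^ j * Rpower L (e * INR j))).
    + apply Rmult_le_compat; try apply Rabs_pos; apply HJ; lia.
    + rewrite <- Hij, plus_INR, Rmult_plus_distr_l, Rpower_plus, pow_add. ring.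
  - apply Req_le. unfold L.
    rewrite <- Rpower_mult_distr by lra.
    rewrite !Rpow_mult_distr.
    rewrite <- (Rpower_pow m (Rpower c e)) by apply exp_pos.
    rewrite Rpower_mult. ring.
Qed.

(** * Weight sequences and the growth index *)

(** The element and the bound exclude the infinite values, on which [real] would return the default
    0. *)
Lemma real_Lub_spec (E : R -> Prop) (z0 U : R) :
  E z0 -> (forall z, E z -> z <= U) ->
  (forall z, E z -> z <= real (Lub_Rbar E)) /\
  (forall u, (forall z, E z -> z <= u) -> real (Lub_Rbar E) <= u).
Proof.
  intros Hz0 HU. destruct (Lub_Rbar_correct E) as [H1 H2].
  assert (HUb : Rbar_le (Lub_Rbar E) U) by (apply H2; intros z Hz; simpl; now apply HU).
  pose proof (H1 z0 Hz0) as H0.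
  destruct (Lub_Rbar E) as [l| |]; simpl in *; try contradiction.
  split; [exact H1|]. intros u Hu. apply (H2 (Finite u)). exact Hu.
Qed.

Lemma real_Glb_spec (E : R -> Prop) (z0 U : R) :
  E z0 -> (forall z, E z -> U <= z) ->
  (forall z, E z -> real (Glb_Rbar E) <= z) /\
  (forall u, (forall z, E z -> u <= z) -> u <= real (Glb_Rbar E)).
Proof.
  intros Hz0 HU. destruct (Glb_Rbar_correct E) as [H1 H2].
  assert (HUb : Rbar_le U (Glb_Rbar E)) by (apply H2; intros z Hz; simpl; now apply HU).
  pose proof (H1 z0 Hz0) as H0.
  destruct (Glb_Rbar E) as [l| |]; simpl in *; try contradiction.
  split; [exact H1|]. intros u Hu. apply (H2 (Finite u)). exact Hu.
Qed.

Lemma exp_le (x y : R) : x <= y -> exp x <= exp y.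
Proof.
  intros H. destruct (Rle_lt_or_eq_dec _ _ H) as [H'|H'].
  - now apply Rlt_le, exp_increasing.
  - subst; lra.
Qed.

Lemma phi_nonneg (w : R -> R) (y : R) : W0 w -> 0 <= phi w y.
Proof. intros Hw. apply (W0_nonneg _ Hw), Rlt_le, exp_pos. Qed.

Lemma phi_conj_spec (w : R -> R) (x : R) :
  W0 w -> 0 <= x ->
  (forall y, 0 <= y -> x * y - phi w y <= phi_conj w x) /\
  (forall u, (forall y, 0 <= y -> x * y - phi w y <= u) -> phi_conj w x <= u).
Proof.
  intros Hw Hx.
  set (E := fun z => exists y,
    (zero_on_unit_interval w -> 0 <= y) /\ z = x * y - phi w y).
  (* This constant gives [phi w y >= (x + 1) * y] for large [y], where [x * y - phi w y] is then
     negative; so the supremum is bounded by its values up to a fixed point. *)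
  destruct (W0_log _ Hw (mkposreal (/ (x + 1)) ltac:(apply Rinv_0_lt_compat; lra)))
    as [T HT].
  destruct (real_Lub_spec E (x * 0 - phi w 0) (x * Rmax 0 (ln (Rmax T 1)))) as [H1 H2].
  - exists 0. split; [lra|reflexivity].
  - intros z [y [Hy ->]]. specialize (Hy (W0_zero _ Hw)).
    pose proof (phi_nonneg w y Hw) as Hp.
    pose proof (Rmax_l 0 (ln (Rmax T 1))) as Hm1.
    pose proof (Rmax_r 0 (ln (Rmax T 1))) as Hm2.
    set (m := Rmax 0 (ln (Rmax T 1))) in *.
    destruct (Rle_dec y m) as [Hym|Hym].
    + assert (x * y <= x * m) by (apply Rmult_le_compat_l; lra). lra.
    + assert (HTy : T < exp y).
      { apply Rle_lt_trans with (Rmax T 1); [apply Rmax_l|].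
        rewrite <- (exp_ln (Rmax T 1)) by (pose proof (Rmax_r T 1); lra).
        apply exp_increasing. lra. }
      specialize (HT _ HTy). unfold norm in HT; simpl in HT; unfold abs in HT; simpl in HT.
      rewrite ln_exp, (Rabs_pos_eq y), (Rabs_pos_eq (w (exp y))) in HT; try assumption.
      assert (H : (x + 1) * y <= phi w y).
      { apply (Rmult_le_compat_l (x + 1)) in HT; [|lra].
        rewrite <- Rmult_assoc, Rinv_r, Rmult_1_l in HT by lra. exact HT. }
      assert (0 <= x * m) by (apply Rmult_le_pos; assumption). nra.
  - split.
    + intros y Hy. apply H1. exists y; split; [intros; assumption|reflexivity].
    + intros u Hu. apply H2. intros z [y [Hy ->]]. apply Hu, Hy, W0_zero, Hw.
Qed.

Lemma phi_0 (w : R -> R) : W0 w -> phi w 0 = 0.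
Proof. intros Hw. unfold phi. rewrite exp_0. apply (W0_zero _ Hw). lra. Qed.

Lemma phi_conj_nonneg (w : R -> R) (x : R) : W0 w -> 0 <= x -> 0 <= phi_conj w x.
Proof.
  intros Hw Hx. destruct (phi_conj_spec w x Hw Hx) as [H _].
  specialize (H 0 (Rle_refl 0)). rewrite phi_0 in H by assumption. lra.
Qed.

Lemma phi_conj_0 (w : R -> R) : W0 w -> phi_conj w 0 = 0.
Proof.
  intros Hw. apply Rle_antisym; [|apply phi_conj_nonneg; [assumption|lra]].
  destruct (phi_conj_spec w 0 Hw (Rle_refl 0)) as [_ H]. apply H.
  intros y _. pose proof (phi_nonneg w y Hw). lra.
Qed.

(** The conjugate is convex and vanishes at 0, so its quotient by [x] is nondecreasing;
    nonnegativity of [phi w] gives this directly. Superadditivity and monotonicity in [l] both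
    follow. *)
Lemma phi_conj_scal (w : R -> R) (x1 x : R) :
  W0 w -> 0 <= x1 <= x -> 0 < x -> phi_conj w x1 <= x1 / x * phi_conj w x.
Proof.
  intros Hw [Hx1 Hx1x] Hx.
  destruct (phi_conj_spec w x1 Hw Hx1) as [_ H]. apply H. intros y Hy.
  destruct (phi_conj_spec w x Hw (Rlt_le _ _ Hx)) as [H' _]. specialize (H' y Hy).
  pose proof (phi_nonneg w y Hw).
  assert (Hq : 0 <= x1 / x <= 1).
  { split; [apply Rmult_le_pos; [lra|apply Rlt_le, Rinv_0_lt_compat; lra]|].
    apply Rmult_le_reg_r with x; [lra|]. unfold Rdiv.
    rewrite Rmult_assoc, Rinv_l by lra. lra. }
  apply Rle_trans with (x1 / x * (x * y - phi w y)).
  - replace (x1 / x * (x * y - phi w y)) with (x1 * y - x1 / x * phi w y) by (field; lra).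
    nra.
  - apply Rmult_le_compat_l; [apply Hq|assumption].
Qed.

Lemma phi_conj_superadditive (w : R -> R) (x1 x2 : R) :
  W0 w -> 0 <= x1 -> 0 <= x2 -> phi_conj w x1 + phi_conj w x2 <= phi_conj w (x1 + x2).
Proof.
  intros Hw H1 H2. destruct (Req_dec (x1 + x2) 0) as [E|E].
  - replace x1 with 0 by lra. replace x2 with 0 by lra.
    rewrite Rplus_0_l, phi_conj_0 by assumption. lra.
  - pose proof (phi_conj_scal w x1 (x1 + x2) Hw ltac:(lra) ltac:(lra)).
    pose proof (phi_conj_scal w x2 (x1 + x2) Hw ltac:(lra) ltac:(lra)).
    replace (phi_conj w (x1 + x2)) with
      (x1 / (x1 + x2) * phi_conj w (x1 + x2) + x2 / (x1 + x2) * phi_conj w (x1 + x2))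
      by (field; lra).
    lra.
Qed.

Lemma weight_seq_pos (w : R -> R) (l : R) (p : nat) : 0 < weight_seq w l p.
Proof. apply exp_pos. Qed.

Lemma weight_seq_0 (w : R -> R) (l : R) : W0 w -> weight_seq w l 0 = 1.
Proof.
  intros Hw. unfold weight_seq. simpl INR.
  rewrite Rmult_0_r, phi_conj_0, Rmult_0_r by assumption. apply exp_0.
Qed.

Lemma weight_seq_superadd (w : R -> R) (l : R) (i j : nat) :
  W0 w -> 0 < l -> weight_seq w l i * weight_seq w l j <= weight_seq w l (i + j).
Proof.
  intros Hw Hl. unfold weight_seq. rewrite <- exp_plus. apply exp_le.
  rewrite plus_INR, Rmult_plus_distr_l, <- Rmult_plus_distr_l.
  apply Rmult_le_compat_l; [now apply Rlt_le, Rinv_0_lt_compat|].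
  apply phi_conj_superadditive; try assumption;
    (apply Rmult_le_pos; [lra|apply pos_INR]).
Qed.

(** The value of the conjugate is bounded below by its competitor [y = ln t], admissible because
    [1 <= t]. *)
Lemma weight_seq_ge (w : R -> R) (l t : R) (p : nat) :
  W0 w -> 0 < l -> 1 <= t -> t ^ p * exp (- (w t / l)) <= weight_seq w l p.
Proof.
  intros Hw Hl Ht. unfold weight_seq.
  rewrite <- (exp_ln (t ^ p)) by (apply pow_lt; lra).
  rewrite <- exp_plus. apply exp_le.
  rewrite <- Rpower_pow, ln_Rpower by lra.
  destruct (phi_conj_spec w (l * INR p) Hw) as [H _].
  { apply Rmult_le_pos; [lra|apply pos_INR]. }
  assert (Hln : 0 <= ln t).
  { rewrite <- ln_1. destruct (Rle_lt_or_eq_dec _ _ Ht) as [H'|H'].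
    - apply Rlt_le, ln_increasing; lra.
    - subst; lra. }
  specialize (H (ln t) Hln). unfold phi in H. rewrite exp_ln in H by lra.
  apply (Rmult_le_compat_l (/ l)) in H; [|now apply Rlt_le, Rinv_0_lt_compat].
  eapply Rle_trans; [|exact H]. apply Req_le. field. lra.
Qed.

Lemma weight_seq_mono (w : R -> R) (l' l : R) (p : nat) :
  W0 w -> 0 < l' <= l -> weight_seq w l' p <= weight_seq w l p.
Proof.
  intros Hw [Hl' Hl]. unfold weight_seq. apply exp_le.
  pose proof (pos_INR p) as Hp.
  destruct (Req_dec (INR p) 0) as [E|E].
  - rewrite E, !Rmult_0_r, phi_conj_0 by assumption. lra.
  - assert (Hp' : 0 < INR p) by lra.
    pose proof (phi_conj_scal w (l' * INR p) (l * INR p) Hw) as H.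
    assert (H' : phi_conj w (l' * INR p) <= l' / l * phi_conj w (l * INR p)).
    { replace (l' / l) with (l' * INR p / (l * INR p)) by (field; lra).
      apply H; [split|]; nra. }
    apply (Rmult_le_compat_l (/ l')) in H'; [|now apply Rlt_le, Rinv_0_lt_compat].
    eapply Rle_trans; [exact H'|]. apply Req_le. field. lra.
Qed.

(** If [f] exceeded [K] arbitrarily far out, every tail supremum would be at least [K], and so would
    their infimum. *)
Lemma limsup_pinfty_lt (f : R -> R) (K : R) :
  Rbar_lt (limsup_pinfty f) K -> exists T, forall t, T <= t -> f t <= K.
Proof.
  intros H. unfold limsup_pinfty in H.
  apply NNPP. intros Hno.
  set (E := fun s => exists T, s = Lub_Rbar (fun y => exists t, T <= t /\ y = f t)) in H.
  assert (HK : Rbar_le K (Rbar_glb E)).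
  { apply (proj2 (proj2_sig (Rbar_ex_glb E))). intros s [T ->].
    apply Rbar_not_lt_le. intros Hlt. apply Hno. exists T. intros t Ht.
    destruct (Lub_Rbar_correct (fun y => exists t, T <= t /\ y = f t)) as [H1 _].
    specialize (H1 (f t) (ex_intro _ t (conj Ht eq_refl))).
    pose proof (Rbar_le_lt_trans _ _ _ H1 Hlt) as H2. simpl in H2. lra. }
  exact (Rbar_le_not_lt _ _ HK H).
Qed.

Lemma Rpower_pos (x y : R) : 0 < Rpower x y.
Proof. apply exp_pos. Qed.

Lemma Rpower_ge_1 (x y : R) : 1 <= x -> 0 <= y -> 1 <= Rpower x y.
Proof.
  intros Hx Hy. rewrite <- (Rpower_O x) by lra. now apply Rle_Rpower.
Qed.

(** An admissible [g > 1] gives [w (Q t) <= K * w t] for large [t], with [Q = K ^ g]. The power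
    [t ^ (1 / g)] gains exactly the factor [K] under the same dilation, so iteration keeps [w] below
    a multiple of it. *)
Lemma growth_index_gt_1 (w : R -> R) :
  W0 w -> Rbar_lt 1 (growth_index w) ->
  exists g C, 1 < g /\ 0 <= C /\ forall t, 1 <= t -> w t <= C * Rpower t (/ g).
Proof.
  intros Hw Hg. unfold growth_index in Hg.
  assert (Hex : exists g, 1 < g /\ growth_admissible w g).
  { apply NNPP. intros Hno. apply (Rbar_lt_not_le _ _ Hg).
    apply (Lub_Rbar_correct (fun g => g = 0 \/ growth_admissible w g)).
    intros g [->|Ha]; simpl; [lra|].
    apply Rnot_lt_le. intros Hlt. apply Hno. now exists g. }
  destruct Hex as [g [Hg1 [Hg0 [K [HK Hlim]]]]].
  destruct (limsup_pinfty_lt _ _ Hlim) as [T0 HT0].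
  destruct (W0_lim _ Hw (fun y => 0 < y)) as [T1 HT1].
  { exists 0. intros; assumption. }
  (* Beyond [T] the quotient is bounded by [K] and [w] is positive, so that the quotient can be
     cleared. *)
  set (T := Rmax 1 (Rmax T0 (T1 + 1))).
  assert (HT : 1 <= T /\ T0 <= T /\ T1 < T).
  { pose proof (Rmax_l 1 (Rmax T0 (T1 + 1))). pose proof (Rmax_r 1 (Rmax T0 (T1 + 1))).
    pose proof (Rmax_l T0 (T1 + 1)). pose proof (Rmax_r T0 (T1 + 1)). unfold T. lra. }
  destruct HT as [HTa [HTb HTc]]. clearbody T.
  set (Q := Rpower K g) in *.
  assert (HQ : 1 < Q) by (unfold Q; rewrite <- (Rpower_O K) by lra; apply Rpower_lt; lra).
  assert (HQg : Rpower Q (/ g) = K).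
  { unfold Q. rewrite Rpower_mult, Rinv_r, Rpower_1 by lra. reflexivity. }
  assert (Hb : 0 < / g) by (apply Rinv_0_lt_compat; lra).
  assert (Hstep : forall t, T <= t -> w (Q * t) <= K * w t).
  { intros t Ht. assert (Hwt : 0 < w t) by (apply HT1; lra).
    specialize (HT0 t ltac:(lra)).
    apply (Rmult_le_compat_r (w t)) in HT0; [|lra].
    unfold Rdiv in HT0. rewrite Rmult_assoc, Rinv_l, Rmult_1_r in HT0 by lra. exact HT0. }
  assert (HwT : 0 <= w T) by (apply (W0_nonneg _ Hw); lra).
  (* Induction over the blocks bounded by [T * Q ^ (i + 1)]: a point beyond [T * Q] is divided by
     [Q]. *)
  assert (Hind : forall i t, T <= t -> t <= T * Q ^ S i ->
    w t <= K * w T * Rpower (t / T) (/ g)).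
  { intros i; induction i as [|i IH]; intros t Ht Hti.
    - apply Rle_trans with (w (Q * T)).
      + apply (W0_nondecreasing _ Hw); [lra|]. simpl in Hti. lra.
      + apply Rle_trans with (K * w T); [apply Hstep; lra|].
        rewrite <- (Rmult_1_r (K * w T)) at 1. apply Rmult_le_compat_l; [nra|].
        apply Rpower_ge_1; [|lra].
        apply Rmult_le_reg_r with T; [lra|]. unfold Rdiv.
        rewrite Rmult_assoc, Rinv_l by lra. lra.
    - destruct (Rle_dec t (T * Q)) as [Htq|Htq].
      + apply (IH t Ht). eapply Rle_trans; [exact Htq|].
        apply Rmult_le_compat_l; [lra|]. rewrite <- (pow_1 Q) at 1.
        apply Rle_pow; [lra|lia].
      + assert (H1 : T <= t / Q).
        { apply Rmult_le_reg_r with Q; [lra|]. unfold Rdiv.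
          rewrite Rmult_assoc, Rinv_l by lra. lra. }
        assert (H2 : t / Q <= T * Q ^ S i).
        { apply Rmult_le_reg_r with Q; [lra|]. unfold Rdiv.
          rewrite Rmult_assoc, Rinv_l, Rmult_1_r by lra.
          eapply Rle_trans; [exact Hti|]. apply Req_le. simpl. ring. }
        specialize (IH _ H1 H2). specialize (Hstep _ H1).
        replace (Q * (t / Q)) with t in Hstep by (field; lra).
        assert (E : Rpower (t / T) (/ g) = K * Rpower (t / Q / T) (/ g)).
        { rewrite <- HQg, Rpower_mult_distr.
          - f_equal. field. lra.
          - lra.
          - apply Rdiv_lt_0_compat; lra. }
        rewrite E. nra. }
  exists g, (K * w T). split; [assumption|]. split; [nra|].
  intros t Ht. destruct (Rle_dec t T) as [HtT|HtT].
  - apply Rle_trans with (w T); [apply (W0_nondecreasing _ Hw); lra|].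
    pose proof (Rpower_ge_1 t (/ g) Ht (Rlt_le _ _ Hb)).
    assert (w T <= K * w T) by nra. nra.
  - destruct (Pow_x_infinity Q) with (b := t) as [N HN].
    { rewrite Rabs_pos_eq; lra. }
    specialize (HN (S N) ltac:(lia)). rewrite Rabs_pos_eq in HN by (apply pow_le; lra).
    eapply Rle_trans; [apply (Hind N t); [lra|]|].
    + apply Rge_le in HN. nra.
    + apply Rmult_le_compat_l; [nra|]. apply Rle_Rpower_l; [lra|]. split.
      * apply Rdiv_lt_0_compat; lra.
      * apply Rmult_le_reg_r with T; [lra|]. unfold Rdiv.
        rewrite Rmult_assoc, Rinv_l by lra. nra.
Qed.

(** Evaluate [weight_seq_ge] at [t = p ^ g]: there [w t <= C * p], so the exponential loss is only
    the geometric factor [exp (C / l) ^ p]. The exponent [g > 1] is the same for all [l]. *)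
Lemma weight_seq_gevrey (w : R -> R) :
  W0 w -> Rbar_lt 1 (growth_index w) ->
  exists g, 1 < g /\ forall l, 0 < l -> exists D, 0 < D /\ forall p : nat,
    Rpower (INR p) (g * INR p) <= D ^ p * weight_seq w l p.
Proof.
  intros Hw Hgi. destruct (growth_index_gt_1 w Hw Hgi) as [g [C [Hg [HC Hb]]]].
  exists g. split; [assumption|]. intros l Hl.
  exists (exp (C / l)). split; [apply exp_pos|]. intros p.
  destruct p as [|p].
  { rewrite weight_seq_0 by assumption. simpl INR. rewrite Rmult_0_r.
    unfold Rpower. rewrite Rmult_0_l, exp_0. simpl. lra. }
  set (n := S p). assert (Hn : 1 <= INR n) by (change 1 with (INR 1); apply le_INR; lia).
  set (t := Rpower (INR n) g).
  assert (Ht : 1 <= t) by (apply Rpower_ge_1; lra).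
  assert (Htg : Rpower t (/ g) = INR n).
  { unfold t. rewrite Rpower_mult, Rinv_r, Rpower_1 by lra. reflexivity. }
  specialize (Hb t Ht). rewrite Htg in Hb.
  pose proof (weight_seq_ge w l t n Hw Hl Ht) as H.
  replace (Rpower (INR n) (g * INR n)) with (t ^ n).
  2: { rewrite <- Rpower_pow by lra. unfold t. now rewrite Rpower_mult. }
  apply Rle_trans with (exp (w t / l) * weight_seq w l n).
  - apply (Rmult_le_compat_l (exp (w t / l))) in H; [|apply Rlt_le, exp_pos].
    eapply Rle_trans; [|exact H]. apply Req_le.
    rewrite exp_Ropp. field. apply Rgt_not_eq, exp_pos.
  - apply Rmult_le_compat_r; [apply Rlt_le, weight_seq_pos|].
    rewrite <- Rpower_pow by apply exp_pos. unfold Rpower. rewrite ln_exp.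
    apply exp_le. replace (INR n * (C / l)) with (C * INR n / l) by (field; lra).
    apply Rmult_le_compat_r; [now apply Rlt_le, Rinv_0_lt_compat|assumption].
Qed.

(** Once [p ^ d] exceeds [A = |B| + 1] the inequality holds factor by factor; the finitely many
    smaller [p] go into [D]. *)
Lemma geometric_le_factorial_power (B d : R) :
  0 < d -> exists D, 0 < D /\ forall p : nat, B ^ p <= D * Rpower (INR p) (d * INR p).
Proof.
  intros Hd. set (A := Rabs B + 1).
  assert (HA : 1 <= A) by (unfold A; pose proof (Rabs_pos B); lra).
  destruct (Rle_dec 0 (Rpower A (/ d))) as [H0|H0].
  2: { exfalso; apply H0, Rlt_le, Rpower_pos. }
  destruct (nfloor_ex (Rpower A (/ d)) H0) as [p0 [_ Hp0]].
  exists (A ^ (p0 + 1)). split; [apply pow_lt; lra|]. intros p.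
  apply Rle_trans with (A ^ p).
  { eapply Rle_trans; [apply Rle_abs|]. rewrite <- RPow_abs. apply pow_incr.
    unfold A; pose proof (Rabs_pos B); lra. }
  destruct p as [|p].
  { simpl INR. rewrite Rmult_0_r. unfold Rpower. rewrite Rmult_0_l, exp_0, Rmult_1_r.
    now apply pow_R1_Rle. }
  set (n := S p). assert (Hn : 1 <= INR n) by (change 1 with (INR 1); apply le_INR; lia).
  assert (H1 : 1 <= A ^ (p0 + 1)) by now apply pow_R1_Rle.
  assert (H2 : 1 <= Rpower (INR n) (d * INR n)) by (apply Rpower_ge_1; nra).
  destruct (Nat.le_gt_cases n (p0 + 1)) as [Hle|Hgt].
  - apply Rle_trans with (A ^ (p0 + 1)); [now apply Rle_pow|nra].
  - apply Rle_trans with (Rpower (INR n) (d * INR n)); [|nra].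
    rewrite <- Rpower_mult, Rpower_pow by apply Rpower_pos.
    apply pow_incr. split; [lra|].
    replace A with (Rpower (Rpower A (/ d)) d).
    2: { rewrite Rpower_mult, Rinv_l, Rpower_1 by lra. reflexivity. }
    apply Rle_Rpower_l; [lra|]. split; [apply Rpower_pos|].
    apply Rlt_le. eapply Rlt_le_trans; [exact Hp0|].
    replace (INR p0 + 1) with (INR (p0 + 1)) by (rewrite plus_INR; reflexivity).
    apply le_INR. lia.
Qed.

Lemma fact_le_pow (p : nat) : INR (fact p) <= INR p ^ p.
Proof.
  assert (H : (fact p <= p ^ p)%nat).
  { assert (G : forall q, (q <= p)%nat -> (fact q <= p ^ q)%nat).
    { intros q; induction q as [|q IH]; intros Hq; [simpl; lia|].
      change (fact (S q)) with (S q * fact q)%nat.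
      change (p ^ S q)%nat with (p * p ^ q)%nat. apply Nat.mul_le_mono; [lia|].
      apply IH; lia. }
    now apply G. }
  apply le_INR in H. now rewrite pow_INR in H.
Qed.

(** The term of index [p] in the exponential series at [p] is at most the whole sum. *)
Lemma pow_le_exp_fact (p : nat) : INR p ^ p <= exp (INR p) * INR (fact p).
Proof.
  pose proof (exp_ge_taylor (INR p) p (pos_INR p)) as H.
  assert (Hf : 0 < INR (fact p)) by apply INR_fact_lt_0.
  assert (H' : INR p ^ p / INR (fact p) <= exp (INR p)).
  { eapply Rle_trans; [|exact H]. destruct p as [|p]; [simpl; lra|].
    rewrite tech5.
    assert (0 <= sum_f_R0 (fun k => INR (S p) ^ k / INR (fact k)) p).
    { apply cond_pos_sum. intros k. apply Rmult_le_pos.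
      - apply pow_le, pos_INR.
      - apply Rlt_le, Rinv_0_lt_compat, INR_fact_lt_0. }
    lra. }
  apply (Rmult_le_compat_r (INR (fact p))) in H'; [|lra].
  unfold Rdiv in H'. rewrite Rmult_assoc, Rinv_l in H' by lra. lra.
Qed.

(** * The weight of the target space *)

Lemma rpow_pos (t b : R) : 0 < t -> rpow t b = Rpower t b.
Proof. intros Ht. unfold rpow. destruct (Rle_dec t 0); [lra|reflexivity]. Qed.

Lemma rpow_neg (t b : R) : t <= 0 -> rpow t b = 0.
Proof. intros Ht. unfold rpow. destruct (Rle_dec t 0); [reflexivity|lra]. Qed.

Lemma rpow_div_Rpower (t u alpha : R) :
  0 < alpha -> 0 < u -> rpow (t / Rpower u (- alpha)) (1 / alpha) = rpow t (1 / alpha) * u.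
Proof.
  intros Ha Hu. pose proof (Rpower_pos u (- alpha)) as Hv.
  destruct (Rle_dec t 0) as [Ht|Ht].
  - rewrite !rpow_neg; [ring|assumption|].
    apply Rmult_le_reg_r with (Rpower u (- alpha)); [assumption|].
    unfold Rdiv. rewrite Rmult_assoc, Rinv_l by lra. lra.
  - rewrite !rpow_pos; [|lra|apply Rdiv_lt_0_compat; lra].
    unfold Rdiv. rewrite <- Rpower_Ropp, Ropp_involutive.
    rewrite <- Rpower_mult_distr by (try apply Rpower_pos; lra).
    rewrite Rpower_mult. f_equal.
    replace (alpha * (1 * / alpha)) with 1 by (field; lra). now apply Rpower_1.
Qed.

(** The substitution [v = u ^ (- alpha)] maps the positive half line onto itself, and both infima
    are taken over the same set of values. *)
Lemma lower_star_eq_check_star (tau : R -> R) (alpha : R) :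
  0 < alpha ->
  pow_arg (lower_star (pow_arg (inv_arg tau) alpha)) (1 / alpha)
  = check_star tau (id_pow (1 / alpha)).
Proof.
  intros Ha. apply functional_extensionality; intros t.
  unfold pow_arg, lower_star, inv_arg, check_star, id_pow. f_equal.
  apply Glb_Rbar_eqset. intros z; split; intros [u [Hu ->]].
  - exists (Rpower u (- alpha)). split; [apply Rpower_pos|].
    rewrite rpow_div_Rpower by assumption.
    rewrite (rpow_pos u) by assumption.
    replace (1 / Rpower u alpha) with (Rpower u (- alpha)); [reflexivity|].
    rewrite Rpower_Ropp. unfold Rdiv. ring.
  - exists (Rpower u (- / alpha)). split; [apply Rpower_pos|].
    rewrite <- rpow_div_Rpower by (try assumption; apply Rpower_pos).
    rewrite (rpow_pos (Rpower u _)) by apply Rpower_pos.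
    rewrite !Rpower_mult.
    replace (- / alpha * - alpha) with 1 by (field; lra).
    replace (- / alpha * alpha) with (- (1)) by (field; lra).
    rewrite Rpower_Ropp, Rpower_1 by assumption.
    replace (1 / / u) with u by (field; lra). reflexivity.
Qed.

Lemma check_star_spec (tau : R -> R) (alpha t : R) :
  W0 tau ->
  (forall u, 0 < u ->
     check_star tau (id_pow (1 / alpha)) t <= tau u + rpow (t / u) (1 / alpha)) /\
  (forall c, (forall u, 0 < u -> c <= tau u + rpow (t / u) (1 / alpha)) ->
     c <= check_star tau (id_pow (1 / alpha)) t).
Proof.
  intros Hw.
  destruct (real_Glb_spec (fun z => exists u, 0 < u /\ z = tau u + id_pow (1 / alpha) (t / u))
    (tau 1 + id_pow (1 / alpha) (t / 1)) 0) as [H1 H2].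
  - exists 1. split; [lra|reflexivity].
  - intros z [u [Hu ->]].
    assert (0 <= tau u) by (apply (W0_nonneg _ Hw); lra).
    assert (0 <= id_pow (1 / alpha) (t / u)).
    { unfold id_pow, rpow. destruct (Rle_dec (t / u) 0); [lra|apply Rlt_le, Rpower_pos]. }
    lra.
  - split.
    + intros u Hu. apply H1. now exists u.
    + intros c Hc. apply H2. intros z [u [Hu ->]]. now apply Hc.
Qed.

(** This decides the branch of [phi_conj]: for this weight the supremum runs over all real [y]. At 1
    the infimum is positive because large [u] makes [tau u > 1], while bounded [u] keeps
    [(1 / u) ^ (1 / alpha)] away from 0. *)
Lemma check_star_not_zero (tau : R -> R) (alpha : R) :
  W0 tau -> 0 < alpha ->
  ~ zero_on_unit_interval (check_star tau (id_pow (1 / alpha))).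
Proof.
  intros Hw Ha H. specialize (H 1 ltac:(lra)).
  destruct (check_star_spec tau alpha 1 Hw) as [_ H2].
  destruct (W0_lim _ Hw (fun y => 1 < y)) as [T HT]; [exists 1; intros; assumption|].
  set (S := Rmax 1 (T + 1)).
  assert (HS : 1 <= S /\ T < S).
  { unfold S. pose proof (Rmax_l 1 (T + 1)). pose proof (Rmax_r 1 (T + 1)). lra. }
  set (c := Rmin 1 (Rpower (1 / S) (1 / alpha))).
  assert (Hc : 0 < c) by (apply Rmin_pos; [lra|apply Rpower_pos]).
  assert (c <= check_star tau (id_pow (1 / alpha)) 1); [|lra].
  apply H2. intros u Hu.
  rewrite rpow_pos by (apply Rdiv_lt_0_compat; lra).
  destruct (Rle_dec u S) as [HuS|HuS].
  - assert (0 <= tau u) by (apply (W0_nonneg _ Hw); lra).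
    assert (Rpower (1 / S) (1 / alpha) <= Rpower (1 / u) (1 / alpha)).
    { apply Rle_Rpower_l.
      - apply Rlt_le, Rdiv_lt_0_compat; lra.
      - split; [apply Rdiv_lt_0_compat; lra|].
        unfold Rdiv. rewrite !Rmult_1_l. apply Rinv_le_contravar; lra. }
    pose proof (Rmin_r 1 (Rpower (1 / S) (1 / alpha))). unfold c. lra.
  - pose proof (HT u ltac:(lra)). pose proof (Rpower_pos (1 / u) (1 / alpha)).
    pose proof (Rmin_l 1 (Rpower (1 / S) (1 / alpha))). unfold c. lra.
Qed.

Lemma exp_conj_le (x alpha b : R) :
  0 < alpha -> 0 < x -> x * b - exp (b / alpha) <= alpha * x * ln (alpha * x) - alpha * x.
Proof.
  intros Ha Hx. assert (Hax : 0 < alpha * x) by now apply Rmult_lt_0_compat.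
  pose proof (exp_ineq1_le (b / alpha - ln (alpha * x))) as H.
  assert (E : exp (b / alpha) = alpha * x * exp (b / alpha - ln (alpha * x))).
  { unfold Rminus. rewrite exp_plus, exp_Ropp, exp_ln by assumption. field. split; lra. }
  rewrite E. apply (Rmult_le_compat_l (alpha * x)) in H; [|lra].
  replace (x * b) with (alpha * x * (b / alpha)) by (field; lra). nra.
Qed.

Lemma rpow_exp (a y alpha : R) :
  0 < alpha -> rpow (exp y / exp a) (1 / alpha) = exp ((y - a) / alpha).
Proof.
  intros Ha. rewrite rpow_pos by (apply Rdiv_lt_0_compat; apply exp_pos).
  unfold Rdiv at 1. rewrite <- exp_Ropp, <- exp_plus. unfold Rpower. rewrite ln_exp.
  f_equal. field. lra.
Qed.

Lemma phi_conj_all (w : R -> R) (x a : R) :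
  W0 w -> 0 <= x -> x * a - phi w a <= phi_conj w x.
Proof.
  intros Hw Hx. destruct (Rle_dec 0 a) as [Ha|Ha].
  - now apply phi_conj_spec.
  - pose proof (phi_conj_nonneg w x Hw Hx). pose proof (phi_nonneg w a Hw). nra.
Qed.

(* The supremum over [b] of [x b - exp (b / alpha)], attained at
   [b = alpha ln (alpha x)]; for [x = 0] the supremum 0 is not attained. *)
Definition gevrey_conj (alpha x : R) : R :=
  if Req_dec_T x 0 then 0 else alpha * x * ln (alpha * x) - alpha * x.

(** In logarithmic coordinates [check_star] is the infimal convolution of [phi tau] and
    [exp (y / alpha)]; the conjugate of an infimal convolution is the sum of the conjugates. *)
Lemma phi_conj_check_star (tau : R -> R) (alpha x : R) :
  W0 tau -> 0 < alpha -> 0 <= x ->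
  phi_conj (check_star tau (id_pow (1 / alpha))) x = phi_conj tau x + gevrey_conj alpha x.
Proof.
  intros Hw Ha Hx. set (k := check_star tau (id_pow (1 / alpha))).
  assert (Hk1 : forall y a, phi k y <= phi tau a + exp ((y - a) / alpha)).
  { intros y a. unfold phi at 1, k.
    destruct (check_star_spec tau alpha (exp y) Hw) as [H _].
    specialize (H (exp a) (exp_pos a)). rewrite rpow_exp in H by assumption. exact H. }
  assert (Hk2 : forall y c, (forall a, c <= phi tau a + exp ((y - a) / alpha)) -> c <= phi k y).
  { intros y c Hc. destruct (check_star_spec tau alpha (exp y) Hw) as [_ H].
    apply H. intros u Hu. specialize (Hc (ln u)).
    rewrite <- rpow_exp in Hc by assumption. unfold phi in Hc.
    rewrite exp_ln in Hc by assumption. exact Hc. }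
  assert (UB : forall y, x * y - phi k y <= phi_conj tau x + gevrey_conj alpha x).
  { intros y.
    assert (x * y - phi_conj tau x - gevrey_conj alpha x <= phi k y); [|lra].
    apply Hk2. intros a.
    pose proof (phi_conj_all tau x a Hw Hx) as H1.
    assert (H2 : x * (y - a) - exp ((y - a) / alpha) <= gevrey_conj alpha x).
    { unfold gevrey_conj. destruct (Req_dec_T x 0) as [->|Hx0].
      - pose proof (exp_pos ((y - a) / alpha)). lra.
      - apply exp_conj_le; lra. }
    lra. }
  destruct (real_Lub_spec (fun z => exists y,
    (zero_on_unit_interval k -> 0 <= y) /\ z = x * y - phi k y)
    (x * 0 - phi k 0) (phi_conj tau x + gevrey_conj alpha x)) as [H1 H2].
  { exists 0. split; [intros; lra|reflexivity]. }
  { intros z [y [_ ->]]. apply UB. }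
  assert (H1' : forall y, x * y - phi k y <= phi_conj k x).
  { intros y. apply H1. exists y. split; [|reflexivity].
    intros Hz. exfalso. exact (check_star_not_zero tau alpha Hw Ha Hz). }
  apply Rle_antisym.
  { apply H2. intros z [y [_ ->]]. apply UB. }
  assert (G : forall b, phi_conj tau x + (x * b - exp (b / alpha)) <= phi_conj k x).
  { intros b.
    assert (phi_conj tau x <= phi_conj k x - (x * b - exp (b / alpha))); [|lra].
    apply (phi_conj_spec tau x Hw Hx). intros a _.
    specialize (H1' (a + b)). pose proof (Hk1 (a + b) a) as H3.
    replace (a + b - a) with b in H3 by ring. lra. }
  unfold gevrey_conj. destruct (Req_dec_T x 0) as [Hx0|Hx0].
  (* At [x = 0] no [b] attains the supremum, so a hypothetical gap [e] is contradicted by the [b]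
     with [exp (b / alpha) = e / 2]. *)
  - subst x. apply Rnot_lt_le. intros Hlt.
    set (e := phi_conj tau 0 + 0 - phi_conj k 0).
    specialize (G (alpha * ln (e / 2))).
    replace (alpha * ln (e / 2) / alpha) with (ln (e / 2)) in G by (field; lra).
    rewrite exp_ln in G by (unfold e; lra). unfold e in G. lra.
  - assert (Hax : 0 < alpha * x) by (apply Rmult_lt_0_compat; lra).
    specialize (G (alpha * ln (alpha * x))).
    replace (alpha * ln (alpha * x) / alpha) with (ln (alpha * x)) in G by (field; lra).
    rewrite exp_ln in G by assumption. lra.
Qed.

Lemma weight_seq_check_star (tau : R -> R) (alpha l : R) (p : nat) :
  W0 tau -> 0 < alpha -> 0 < l ->
  weight_seq (check_star tau (id_pow (1 / alpha))) l p
  = weight_seq tau l p * (Rpower (alpha * l / exp 1) alpha ^ p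
                          * Rpower (INR p) (alpha * INR p)).
Proof.
  intros Hw Ha Hl. pose proof (pos_INR p) as Hp. unfold weight_seq.
  rewrite phi_conj_check_star by (try assumption; apply Rmult_le_pos; lra).
  rewrite Rmult_plus_distr_l, exp_plus. f_equal.
  unfold gevrey_conj. destruct (Req_dec_T (l * INR p) 0) as [E|E].
  - assert (Hp0 : INR p = 0) by nra.
    assert (p = 0%nat) by (apply INR_eq; simpl; exact Hp0). subst p.
    simpl INR. unfold Rpower. rewrite !Rmult_0_r, !Rmult_0_l, exp_0. simpl. ring.
  - assert (Hp0 : 0 < INR p) by (destruct (Req_dec (INR p) 0); nra).
    assert (Hal : 0 < alpha * l) by now apply Rmult_lt_0_compat.
    rewrite <- Rpower_pow, Rpower_mult by apply Rpower_pos.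
    unfold Rpower. rewrite <- exp_plus. f_equal.
    rewrite ln_div by (try assumption; apply exp_pos). rewrite ln_exp.
    replace (alpha * (l * INR p)) with (alpha * l * INR p) by ring.
    rewrite (ln_mult (alpha * l) (INR p)) by assumption. field. lra.
Qed.

Lemma fact_Rpower_le (alpha : R) (p : nat) :
  0 < alpha -> Rpower (INR (fact p)) alpha <= Rpower (INR p) (alpha * INR p).
Proof.
  intros Ha. destruct p as [|p].
  { simpl. unfold Rpower. rewrite ln_1, !Rmult_0_r, Rmult_0_l. lra. }
  assert (Hp : 0 < INR (S p)) by (apply lt_0_INR; lia).
  rewrite (Rmult_comm alpha), <- Rpower_mult, Rpower_pow by assumption.
  apply Rle_Rpower_l; [lra|]. split; [apply INR_fact_lt_0|apply fact_le_pow].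
Qed.

Lemma Rpower_le_fact (alpha : R) (p : nat) :
  0 < alpha ->
  Rpower (INR p) (alpha * INR p) <= exp alpha ^ p * Rpower (INR (fact p)) alpha.
Proof.
  intros Ha. destruct p as [|p].
  { simpl. unfold Rpower. rewrite ln_1, !Rmult_0_r, Rmult_0_l. lra. }
  assert (Hp : 0 < INR (S p)) by (apply lt_0_INR; lia).
  rewrite (Rmult_comm alpha), <- Rpower_mult, Rpower_pow by assumption.
  replace (exp alpha ^ S p) with (Rpower (exp (INR (S p))) alpha).
  2: { rewrite <- Rpower_pow by apply exp_pos. unfold Rpower. rewrite !ln_exp.
       f_equal; ring. }
  rewrite Rpower_mult_distr by (try apply exp_pos; apply INR_fact_lt_0).
  apply Rle_Rpower_l; [lra|]. split; [now apply pow_lt|apply pow_le_exp_fact].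
Qed.

Lemma bound_compare (W W' : nat -> R) (nu : R -> nat -> nat -> R) :
  (forall x j k, 0 <= nu x j k) ->
  (forall p, 0 < W p) -> (forall p, W p <= W' p) ->
  bound (fun r => exists (x : R) (j k : nat), r = nu x j k / W (j + k)%nat) ->
  bound (fun r => exists (x : R) (j k : nat), r = nu x j k / W' (j + k)%nat).
Proof.
  intros Hnu HW HWW [B HB]. exists B. intros r [x [j [k ->]]].
  apply Rle_trans with (nu x j k / W (j + k)%nat).
  - apply Rmult_le_compat_l; [apply Hnu|]. apply Rinv_le_contravar; [apply HW|apply HWW].
  - apply HB. now exists x, j, k.
Qed.

(** By [weight_seq_check_star] the parameter [l] supplies the geometric factor
    [((alpha l / e) ^ alpha) ^ p], which can be made as small as any [h ^ p] by lowering [l];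
    [p ^ p] and [p!] differ only geometrically. *)
Lemma S_weight_check_star_iff (tau : R -> R) (alpha : R) (h : R -> C) :
  W0 tau -> 0 < alpha ->
  S_weight (check_star tau (id_pow (1 / alpha))) h <->
  S_family (mul_gevrey (weight_seq tau) alpha) h.
Proof.
  intros Hw Ha.
  assert (Hnu : forall x j k, 0 <= (1 + Rabs x) ^ k * Cmod (CDerive_n h j x)).
  { intros x j k. apply Rmult_le_pos; [|apply Cmod_ge_0].
    apply pow_le. pose proof (Rabs_pos x). lra. }
  assert (HM : forall l p, 0 < weight_seq tau l p * Rpower (INR (fact p)) alpha).
  { intros l p. apply Rmult_lt_0_compat; [apply weight_seq_pos|apply Rpower_pos]. }
  assert (Hae : 0 < alpha / exp 1) by (apply Rdiv_lt_0_compat; [lra|apply exp_pos]).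
  split; intros [Hs H]; split; try exact Hs.
  - intros l h0 Hl Hh0.
    (* Chosen so that [alpha * l' / e <= d] implies [(alpha * l' / e) ^ alpha * exp alpha <= h0];
       the factor [exp alpha] pays for replacing [p ^ (alpha p)] by [p! ^ alpha]. *)
    set (d := Rpower (h0 / exp alpha) (/ alpha)).
    assert (Hd : 0 < d) by apply Rpower_pos.
    set (l' := Rmin l (d / (alpha / exp 1))).
    assert (Hl' : 0 < l') by (apply Rmin_pos; [assumption|now apply Rdiv_lt_0_compat]).
    refine (bound_compare (weight_seq (check_star tau (id_pow (1 / alpha))) l')
      (fun p => h0 ^ p * mul_gevrey (weight_seq tau) alpha l p) _ Hnu _ _ (H l' Hl')).
    + intros p. apply weight_seq_pos.
    + intros p. rewrite weight_seq_check_star by assumption. unfold mul_gevrey.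
      assert (H1 : Rpower (alpha * l' / exp 1) alpha * exp alpha <= h0).
      { apply Rle_trans with (Rpower d alpha * exp alpha).
        - apply Rmult_le_compat_r; [apply Rlt_le, exp_pos|].
          apply Rle_Rpower_l; [lra|]. split.
          + replace (alpha * l' / exp 1) with (alpha / exp 1 * l')
              by (field; apply Rgt_not_eq, exp_pos). now apply Rmult_lt_0_compat.
          + replace (alpha * l' / exp 1) with (alpha / exp 1 * l')
              by (field; apply Rgt_not_eq, exp_pos).
            apply Rle_trans with (alpha / exp 1 * (d / (alpha / exp 1))).
            * apply Rmult_le_compat_l; [lra|apply Rmin_r].
            * apply Req_le. field. split; [apply Rgt_not_eq, exp_pos|lra].
        - unfold d. rewrite Rpower_mult, Rinv_l, Rpower_1;
            [|apply Rdiv_lt_0_compat; [lra|apply exp_pos]|lra].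
          apply Req_le. field. apply Rgt_not_eq, exp_pos. }
      set (q := Rpower (alpha * l' / exp 1) alpha) in *.
      assert (Hq : 0 < q) by apply Rpower_pos.
      pose proof (weight_seq_mono tau l' l p Hw (conj Hl' (Rmin_l _ _))) as H2.
      pose proof (Rpower_le_fact alpha p Ha) as H3.
      assert (H4 : q ^ p * exp alpha ^ p <= h0 ^ p).
      { rewrite <- Rpow_mult_distr. apply pow_incr. split; [|assumption].
        apply Rmult_le_pos; [lra|apply Rlt_le, exp_pos]. }
      pose proof (weight_seq_pos tau l' p) as HT.
      pose proof (weight_seq_pos tau l p) as HTl.
      pose proof (Rpower_pos (INR (fact p)) alpha) as HF.
      apply Rle_trans with (weight_seq tau l p *
        (q ^ p * (exp alpha ^ p * Rpower (INR (fact p)) alpha))).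
      * apply Rmult_le_compat; try lra.
        -- apply Rmult_le_pos; [apply pow_le; lra|apply Rlt_le, Rpower_pos].
        -- apply Rmult_le_compat_l; [apply pow_le; lra|assumption].
      * replace (weight_seq tau l p * (q ^ p * (exp alpha ^ p * Rpower (INR (fact p)) alpha)))
          with (q ^ p * exp alpha ^ p * (weight_seq tau l p * Rpower (INR (fact p)) alpha))
          by ring.
        apply Rmult_le_compat_r; [apply Rlt_le, HM|assumption].
  - intros l Hl. set (h0 := Rpower (alpha * l / exp 1) alpha).
    assert (Hh0 : 0 < h0) by apply Rpower_pos.
    refine (bound_compare (fun p => h0 ^ p * mul_gevrey (weight_seq tau) alpha l p)
      (weight_seq (check_star tau (id_pow (1 / alpha))) l) _ Hnu _ _ (H l h0 Hl Hh0)).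
    + intros p. apply Rmult_lt_0_compat; [now apply pow_lt|apply HM].
    + intros p. rewrite weight_seq_check_star by assumption. unfold mul_gevrey.
      fold h0.
      pose proof (fact_Rpower_le alpha p Ha) as H3.
      replace (h0 ^ p * (weight_seq tau l p * Rpower (INR (fact p)) alpha))
        with (weight_seq tau l p * (h0 ^ p * Rpower (INR (fact p)) alpha)) by ring.
      apply Rmult_le_compat_l; [apply Rlt_le, weight_seq_pos|].
      apply Rmult_le_compat_l; [apply pow_le; lra|assumption].
Qed.

(** * Composition and selection of signs *)

Definition has_jet (f : R -> R) : Prop := exists F, jet F /\ forall x, F 0%nat x = f x.

Lemma has_jet_const (c : R) : has_jet (fun _ => c).
Proof.
  exists (fun n _ => match n with O => c | S _ => 0 end). split; [|reflexivity].
  intros [|n] x; apply @is_derive_const.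
Qed.

Lemma has_jet_shift (F : nat -> R -> R) (i : nat) : jet F -> has_jet (F i).
Proof.
  intros HF. exists (fun n => F (n + i)%nat). split; [|reflexivity].
  intros n x. apply HF.
Qed.

Lemma has_jet_plus (f g : R -> R) : has_jet f -> has_jet g -> has_jet (fun x => f x + g x).
Proof.
  intros [F [HF EF]] [G [HG EG]]. exists (fun n x => F n x + G n x). split.
  - intros n x. apply (is_derive_plus (F n) (G n)); [apply HF|apply HG].
  - intros x. now rewrite EF, EG.
Qed.

Lemma has_jet_mult (f g : R -> R) : has_jet f -> has_jet g -> has_jet (fun x => f x * g x).
Proof.
  intros [F [HF EF]] [G [HG EG]]. exists (fun n => jet_mul F G n 0 0). split.
  - now apply jet_jet_mul.
  - intros x. simpl. now rewrite EF, EG.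
Qed.

Lemma has_jet_ex_derive (f : R -> R) (x : R) : has_jet f -> ex_derive f x.
Proof.
  intros [F [HF EF]]. eapply ex_derive_ext; [exact EF|]. eexists; apply HF.
Qed.

Lemma has_jet_Derive (f : R -> R) : has_jet f -> has_jet (Derive f).
Proof.
  intros [F [HF EF]]. destruct (has_jet_shift F 1 HF) as [G [HG EG]].
  exists G. split; [exact HG|]. intros x. rewrite EG.
  rewrite <- (Derive_ext _ _ x EF). symmetry. apply is_derive_unique, HF.
Qed.

Lemma sum_f_R0_shift (Q : nat -> R) (n : nat) :
  sum_f_R0 (fun j => match j with O => 0 | S i => Q i end) (S n) = sum_f_R0 Q n.
Proof.
  induction n as [|n IH]; [simpl; ring|].
  rewrite tech5, IH, tech5. reflexivity.
Qed.

Lemma is_derive_sum_f_R0 (f d : nat -> R -> R) (n : nat) (x : R) :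
  (forall j, is_derive (f j) x (d j x)) ->
  is_derive (fun y => sum_f_R0 (fun j => f j y) n) x (sum_f_R0 (fun j => d j x) n).
Proof.
  intros H. induction n as [|n IH]; simpl; [apply H|].
  apply (is_derive_plus (fun y => sum_f_R0 (fun j => f j y) n) (f (S n))); [exact IH|apply H].
Qed.

(* The coefficients [b j] are the partial Bell polynomials of the inner function;
   only the leading one is needed explicitly. *)
Lemma Derive_n_comp_expansion (G : nat -> R -> R) (n : nat) :
  jet G ->
  exists b : nat -> R -> R,
    (forall j, has_jet (b j)) /\
    (forall j x, (n < j)%nat -> b j x = 0) /\
    (forall x, b n x = G 1%nat x ^ n) /\
    (forall F, jet F -> forall x,
       Derive_n (fun t => F 0%nat (G 0%nat t)) n x
       = sum_f_R0 (fun j => b j x * F j (G 0%nat x)) n).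
Proof.
  intros HG. induction n as [|n IH].
  - exists (fun j _ => match j with O => 1 | S _ => 0 end). repeat split.
    + intros j. apply has_jet_const.
    + intros [|j] x Hj; [lia|reflexivity].
    + intros F HF x. simpl. ring.
  - destruct IH as [b [Hb [Hb0 [Hbn HbF]]]].
    (* The product rule gives the recursion [b_(n+1,j) = b_(n,j)' + G' b_(n,j-1)]; [sh] is the shift
       of the index. *)
    set (sh := fun j (x : R) => match j with O => 0 | S i => b i x end).
    assert (Hsh : forall j, has_jet (sh j)).
    { intros [|j]; [apply has_jet_const|apply Hb]. }
    exists (fun j x => Derive (b j) x + G 1%nat x * sh j x).
    assert (HD0 : forall j x, (n < j)%nat -> Derive (b j) x = 0).
    { intros j x Hj. rewrite (Derive_ext (b j) (fun _ => 0)); [apply Derive_const|].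
      intros t. now apply Hb0. }
    repeat split.
    + intros j. apply has_jet_plus; [now apply has_jet_Derive|].
      apply has_jet_mult; [now apply has_jet_shift|apply Hsh].
    + intros j x Hj. rewrite HD0 by lia. destruct j as [|j]; [lia|]. simpl.
      rewrite Hb0 by lia. ring.
    + intros x. rewrite HD0 by lia. simpl. rewrite Hbn. ring.
    + intros F HF x. cbn [Derive_n]. rewrite (Derive_ext _ _ x (HbF F HF)).
      apply is_derive_unique.
      replace (sum_f_R0 _ (S n)) with
        (sum_f_R0 (fun j => Derive (b j) x * F j (G 0%nat x)
            + b j x * (G 1%nat x * F (S j) (G 0%nat x))) n).
      * apply (is_derive_sum_f_R0 (fun j y => b j y * F j (G 0%nat y))
          (fun j x => Derive (b j) x * F j (G 0%nat x)
            + b j x * (G 1%nat x * F (S j) (G 0%nat x)))).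
        intros j.
        apply (is_derive_mult (b j) (fun y => F j (G 0%nat y)) x _ _); [| |exact Rmult_comm].
        -- apply Derive_correct, has_jet_ex_derive, Hb.
        -- apply (is_derive_comp (F j) (G 0%nat)); [apply HF|apply HG].
      * rewrite (sum_eq (fun j => (Derive (b j) x + G 1%nat x * sh j x) * F j (G 0%nat x))
          (fun j => Derive (b j) x * F j (G 0%nat x) +
             match j with O => 0 | S i => b i x * (G 1%nat x * F (S i) (G 0%nat x)) end)).
        -- rewrite !sum_plus, sum_f_R0_shift, (tech5 (fun j => Derive (b j) x * _)).
           rewrite (HD0 (S n) x) by lia. ring.
        -- intros [|j] _; simpl; ring.
Qed.

Lemma is_series_single {K : AbsRing} {V : NormedModule K} (a : nat -> V) (m : nat) :
  (forall k, k <> m -> a k = zero) -> is_series a (a m).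
Proof.
  intros H. unfold is_series.
  apply filterlim_ext_loc with (fun _ => a m); [|apply filterlim_const].
  exists m. intros n Hn.
  assert (H0 : forall n, (n < m)%nat -> sum_n a n = zero).
  { intros i; induction i as [|i IH]; intros Hi.
    - rewrite sum_O. apply H. lia.
    - rewrite sum_Sn, IH, H by lia. apply plus_zero_r. }
  induction Hn as [|n Hn IH].
  - destruct m as [|m]; [now rewrite sum_O|].
    rewrite sum_Sn, H0 by lia. now rewrite plus_zero_l.
  - rewrite sum_Sn, <- IH, (H (S n)) by lia. now rewrite plus_zero_r.
Qed.

Lemma Series_split_last (a : nat -> R) (n : nat) :
  ex_series a -> (forall k, (n < k)%nat -> a k = 0) ->
  Series a = Series (fun k => if (k <? n)%nat then a k else 0) + a n.
Proof.
  intros Ha H0.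
  set (d := fun k => if (k =? n)%nat then a k else 0).
  assert (Hd : is_series d (a n)).
  { replace (a n) with (d n) by (unfold d; now rewrite Nat.eqb_refl).
    apply is_series_single. intros k Hk. unfold d.
    apply Nat.eqb_neq in Hk. now rewrite Hk. }
  assert (E : Series (fun k => if (k <? n)%nat then a k else 0) = Series (fun k => a k - d k)).
  { apply Series_ext. intros k. unfold d.
    destruct (Nat.ltb_spec k n), (Nat.eqb_spec k n); try lia; try ring.
    rewrite H0 by lia. ring. }
  rewrite E, Series_minus; [|assumption|now exists (a n)].
  rewrite (is_series_unique _ _ Hd). ring.
Qed.

Lemma choice_fun {A B : Type} (P : A -> B -> Prop) :
  (forall x, exists y, P x y) -> exists f, forall x, P x (f x).
Proof.
  intros H.
  exists (fun x => proj1_sig (constructive_indefinite_description _ (H x))).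
  intros x. exact (proj2_sig (constructive_indefinite_description _ (H x))).
Qed.

(** As [r n] sees only the signs before [n], the [n]-th sign may be chosen to agree with it; where
    [r n] vanishes the sign 1 is taken. *)
Lemma sign_selection (r : nat -> (nat -> R) -> R) :
  (forall n c c', (forall k, (k < n)%nat -> c k = c' k) -> r n c = r n c') ->
  exists c : nat -> R, forall n, Rabs (c n) = 1 /\ 0 <= c n * r n c.
Proof.
  intros Hr.
  set (sg := fun x => if Rle_dec 0 x then 1 else -1).
  (* [P n] holds the first [n] signs and the default 1 beyond them; later stages never alter an
     earlier sign. *)
  set (P := fix P (n : nat) : nat -> R :=
    match n with
    | O => fun _ => 1
    | S n => fun k => if (k =? n)%nat then sg (r n (P n)) else P n k
    end).
  exists (fun k => P (S k) k). intros n.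
  assert (E : forall m k, (k < m)%nat -> P m k = P (S k) k).
  { intros m; induction m as [|m IH]; intros k Hk; [lia|].
    destruct (Nat.eq_dec k m) as [->|Hne]; [reflexivity|].
    change (P (S m) k) with (if (k =? m)%nat then sg (r m (P m)) else P m k).
    destruct (Nat.eqb_spec k m); [lia|]. apply IH. lia. }
  assert (En : P (S n) n = sg (r n (P n))) by (simpl; now rewrite Nat.eqb_refl).
  rewrite En, (Hr n (fun k => P (S k) k) (P n)) by (intros k Hk; symmetry; now apply E).
  unfold sg. destruct (Rle_dec 0 (r n (P n))); split.
  - apply Rabs_R1.
  - lra.
  - rewrite Rabs_left; lra.
  - lra.
Qed.

(** * Supporting lines of a rapidly growing sequence *)

Lemma argmin_from (q : nat -> R) (n0 J : nat) :
  (forall j, (J <= j)%nat -> q n0 <= q j) ->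
  exists n, (n0 <= n)%nat /\ forall j, (n0 <= j)%nat -> q n <= q j.
Proof.
  intros HJ.
  assert (G : forall m, exists n, (n0 <= n)%nat /\
    forall j, (n0 <= j <= n0 + m)%nat -> q n <= q j).
  { intros m; induction m as [|m [n [Hn IH]]].
    - exists n0. split; [lia|]. intros j Hj. replace j with n0 by lia. lra.
    - destruct (Rle_dec (q n) (q (n0 + S m)%nat)) as [H|H].
      + exists n. split; [assumption|]. intros j Hj.
        destruct (Nat.eq_dec j (n0 + S m)) as [->|]; [assumption|]. apply IH. lia.
      + exists (n0 + S m)%nat. split; [lia|]. intros j Hj.
        destruct (Nat.eq_dec j (n0 + S m)) as [->|]; [lra|].
        apply Rle_trans with (q n); [lra|]. apply IH. lia. }
  destruct (G J) as [n [Hn H]]. exists n. split; [assumption|]. intros j Hj.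
  destruct (Nat.le_gt_cases j (n0 + J)) as [Hle|Hgt]; [apply H; lia|].
  apply Rle_trans with (q n0); [apply H; lia|apply HJ; lia].
Qed.

(* Indices at which [V] touches its log-convex minorant. *)
Definition vertex (V : nat -> R) (n : nat) (N : R) : Prop :=
  0 < N /\ forall j, V n / N ^ n * N ^ j <= V j.

(** For a fixed slope [N] the quotient [V j / N ^ j] tends to infinity, since [V] dominates the
    factorial, and so attains its minimum; a large slope pushes the minimiser beyond [n0]. *)
Lemma vertex_cofinal (V : nat -> R) :
  (forall n, INR (fact n) <= V n) ->
  forall n0, exists n N, (n0 <= n)%nat /\ vertex V n N.
Proof.
  intros HV n0.
  assert (HV1 : forall n, 1 <= V n).
  { intros n. eapply Rle_trans; [|apply HV]. change 1 with (INR 1).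
    apply le_INR. pose proof (lt_O_fact n). lia. }
  (* For [j < n0] this slope gives [V n0 <= N <= V j * N ^ (n0 - j)], so indices below [n0] cannot
     beat [n0]. *)
  set (N := V n0 + 1). assert (HN : 2 <= N) by (unfold N; pose proof (HV1 n0); lra).
  set (q := fun j => V j / N ^ j).
  assert (HNp : forall j, 0 < N ^ j) by (intros j; apply pow_lt; lra).
  assert (Hq : forall j, 0 < q j).
  { intros j. apply Rdiv_lt_0_compat; [pose proof (HV1 j); lra|apply HNp]. }
  destruct (cv_speed_pow_fact N (/ q n0)) as [J HJ].
  { apply Rinv_0_lt_compat, Hq. }
  destruct (argmin_from q n0 J) as [n [Hn Hmin]].
  { intros j Hj. specialize (HJ j Hj). unfold Rdist in HJ.
    rewrite Rminus_0_r, Rabs_pos_eq in HJ.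
    2: { apply Rmult_le_pos; [apply Rlt_le, HNp|apply Rlt_le, Rinv_0_lt_compat, INR_fact_lt_0]. }
    apply Rle_trans with (INR (fact j) / N ^ j).
    - apply Rlt_le. rewrite <- (Rinv_inv (q n0)).
      replace (INR (fact j) / N ^ j) with (/ (N ^ j / INR (fact j))).
      + apply Rinv_lt_contravar; [|assumption]. apply Rmult_lt_0_compat.
        * apply Rdiv_lt_0_compat; [apply HNp|apply INR_fact_lt_0].
        * apply Rinv_0_lt_compat, Hq.
      + field. split; [apply Rgt_not_eq, HNp|apply Rgt_not_eq, INR_fact_lt_0].
    - unfold q. apply Rmult_le_compat_r; [apply Rlt_le, Rinv_0_lt_compat, HNp|apply HV]. }
  exists n, N. split; [assumption|]. split; [lra|]. intros j.
  assert (Hj : q n <= q j).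
  { destruct (Nat.le_gt_cases n0 j) as [Hle|Hgt]; [now apply Hmin|].
    apply Rle_trans with (q n0); [apply Hmin; lia|]. unfold q.
    apply Rmult_le_reg_r with (N ^ n0); [apply HNp|].
    unfold Rdiv. rewrite Rmult_assoc, Rinv_l, Rmult_1_r by (apply Rgt_not_eq, HNp).
    replace n0 with (j + (n0 - j))%nat at 2 by lia. rewrite pow_add.
    rewrite Rmult_assoc, <- (Rmult_assoc (/ N ^ j)), Rinv_l, Rmult_1_l
      by (apply Rgt_not_eq, HNp).
    apply Rle_trans with (1 * N ^ 1); [unfold N; lra|].
    apply Rmult_le_compat; [lra|simpl; lra|apply HV1|]. apply Rle_pow; [lra|lia]. }
  fold (q n). apply (Rmult_le_compat_r (N ^ j)) in Hj; [|apply Rlt_le, HNp].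
  unfold q at 2 in Hj. unfold Rdiv in Hj.
  rewrite Rmult_assoc, Rinv_l, Rmult_1_r in Hj by (apply Rgt_not_eq, HNp). exact Hj.
Qed.

(** * Iterates of psi and the resolvent *)

Lemma psi_iter_jet (m : nat) :
  exists G, jet G /\ forall x, G 0%nat x = Nat.iter m psi x.
Proof.
  induction m as [|m IH].
  - exists (fun n x => match n with O => x | S O => 1 | _ => 0 end).
    split; [|reflexivity]. intros [|[|n]] x.
    + apply @is_derive_id.
    + apply @is_derive_const.
    + apply @is_derive_const.
  - destruct (has_jet_plus _ _ (has_jet_mult _ _ IH IH) (has_jet_const (1 / 4)))
      as [G [HG EG]].
    exists G. split; [assumption|]. intros x. rewrite EG. simpl. unfold psi. ring.
Qed.

(** [psi y - y] is the square [(y - 1 / 2) ^ 2]. *)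
Lemma psi_iter_ge (m : nat) (z : R) : z <= Nat.iter m psi z.
Proof.
  induction m as [|m IH]; [apply Rle_refl|].
  change (Nat.iter (S m) psi z) with (psi (Nat.iter m psi z)).
  set (y := Nat.iter m psi z) in *. unfold psi.
  pose proof (pow2_ge_0 (y - 1 / 2)). nra.
Qed.

Lemma psi_iter_exit (m : nat) (z : R) :
  (0 < m)%nat -> 19 / 20 < z -> 21 / 20 <= Nat.iter m psi z.
Proof.
  intros Hm Hz. destruct m as [|m]; [lia|]. rewrite Nat.iter_succ_r.
  eapply Rle_trans; [|apply psi_iter_ge]. unfold psi. nra.
Qed.

(* The window (19/20, 21/20) is disjoint from its image under [psi], so every
   orbit visits it at most once. *)
Lemma psi_iter_window (m j : nat) (x : R) :
  19 / 20 < Nat.iter m psi x < 21 / 20 -> j <> m ->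
  Nat.iter j psi x <= 19 / 20 \/ 21 / 20 <= Nat.iter j psi x.
Proof.
  intros Hm Hj. destruct (Nat.lt_total j m) as [H|[H|H]]; [|lia|].
  - left. apply Rnot_lt_le. intros Hlt.
    replace m with (m - j + j)%nat in Hm by lia. rewrite Nat.iter_add in Hm.
    pose proof (psi_iter_exit (m - j) _ ltac:(lia) Hlt). lra.
  - right. replace j with (j - m + m)%nat by lia. rewrite Nat.iter_add.
    apply psi_iter_exit; [lia|lra].
Qed.

Fixpoint back_orbit (m : nat) : R :=
  match m with O => 1 | S m => sqrt (back_orbit m - 1 / 4) end.

(** With [e_m = 1 / (m + 2)], the step amounts to [e_(m+1) + e_(m+1)^2 <= e_m], which holds because
    [e_m - e_(m+1) = e_m e_(m+1)]. *)
Lemma back_orbit_ge (m : nat) : 1 / 2 + / (INR m + 2) <= back_orbit m.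
Proof.
  induction m as [|m IH]; [simpl; lra|].
  rewrite S_INR. cbn [back_orbit]. pose proof (pos_INR m).
  assert (H2 : 0 < / (INR m + 2)) by (apply Rinv_0_lt_compat; lra).
  assert (H3 : 0 < / (INR m + 1 + 2)) by (apply Rinv_0_lt_compat; lra).
  rewrite <- (sqrt_pow2 (1 / 2 + / (INR m + 1 + 2))) by lra.
  apply sqrt_le_1_alt.
  assert (E : / (INR m + 2) - / (INR m + 1 + 2) = / (INR m + 2) * / (INR m + 1 + 2))
    by (field; lra).
  assert (/ (INR m + 1 + 2) <= / (INR m + 2)) by (apply Rinv_le_contravar; lra).
  nra.
Qed.

Lemma psi_back_orbit (m : nat) : psi (back_orbit (S m)) = back_orbit m.
Proof.
  cbn [back_orbit]. unfold psi. rewrite pow2_sqrt; [ring|].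
  pose proof (back_orbit_ge m).
  assert (0 < / (INR m + 2)) by (apply Rinv_0_lt_compat; pose proof (pos_INR m); lra).
  lra.
Qed.

Lemma psi_iter_back_orbit (m : nat) : Nat.iter m psi (back_orbit m) = 1.
Proof.
  induction m as [|m IH]; [reflexivity|]. now rewrite Nat.iter_succ_r, psi_back_orbit.
Qed.

(* 1/2 is a parabolic fixed point: the backward orbit approaches it like 1/m,
   which makes the derivative of [psi_m] grow quadratically along it. *)
Lemma psi_iter_derive_back_orbit (m : nat) :
  exists d, is_derive (Nat.iter m psi) (back_orbit m) d /\
            (INR m + 3) * (INR m + 4) / 12 <= d.
Proof.
  induction m as [|m [d [Hd Hge]]].
  - exists 1. split; [apply @is_derive_id|simpl; lra].
  - exists (2 * back_orbit (S m) * d). split.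
    + apply is_derive_ext with (fun x => Nat.iter m psi (psi x)).
      { intros t. now rewrite Nat.iter_succ_r. }
      apply (is_derive_comp (Nat.iter m psi) psi).
      * rewrite psi_back_orbit. exact Hd.
      * unfold psi. auto_derive; [exact I|ring].
    + pose proof (back_orbit_ge (S m)) as Hb. rewrite S_INR in *. pose proof (pos_INR m).
      (* The first factor equals [(m + 5) / (m + 3)], so the product telescopes to
         [(m + 4) (m + 5) / 12]. *)
      apply Rle_trans with (2 * (1 / 2 + / (INR m + 1 + 2)) * ((INR m + 3) * (INR m + 4) / 12)).
      * apply Req_le. field. lra.
      * assert (0 < / (INR m + 1 + 2)) by (apply Rinv_0_lt_compat; lra).
        apply Rmult_le_compat; try nra.
Qed.

(** An orbit meets the window at most once, so the series has at most one nonzero term at each point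
    and its sum is explicit. *)
Lemma resolvent_exists (mu : C) (F : R -> R) :
  (forall x, x <= 19 / 20 \/ 21 / 20 <= x -> F x = 0) ->
  exists g : R -> C,
    is_resolvent mu psi (fun x => RtoC (F x)) g /\
    forall m x, 19 / 20 < Nat.iter m psi x < 21 / 20 ->
      g x = Cdiv (RtoC (F (Nat.iter m psi x))) (Cpow mu (S m)).
Proof.
  intros HF.
  set (a := fun x m => Cdiv (RtoC (F (Nat.iter m psi x))) (Cpow mu (S m))).
  assert (Ha : forall x m, F (Nat.iter m psi x) = 0 -> a x m = zero).
  { intros x m E. unfold a. rewrite E. apply Cmult_0_l. }
  assert (Hex : forall x, exists v : C, is_series (a x) v /\
    forall m, 19 / 20 < Nat.iter m psi x < 21 / 20 -> v = a x m).
  { intros x.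
    destruct (classic (exists m, 19 / 20 < Nat.iter m psi x < 21 / 20)) as [[m Hm]|Hno].
    - exists (a x m). split.
      + apply is_series_single. intros k Hk. apply Ha, HF.
        now apply (psi_iter_window m).
      + intros k Hk. destruct (Nat.eq_dec k m) as [->|Hne]; [reflexivity|].
        destruct (psi_iter_window m k x Hm Hne); lra.
    (* The orbit misses the window and all terms vanish; the first one serves as the sum 0. *)
    - exists (a x 0%nat).
      assert (Hz : forall k, a x k = zero).
      { intros k. apply Ha, HF. apply NNPP. intros Hn. apply Hno. exists k. lra. }
      split.
      + apply is_series_single. intros k _. apply Hz.
      + intros m Hm. exfalso. apply Hno. now exists m. }
  destruct (choice_fun _ Hex) as [g Hg]. exists g. split.
  - intros x. apply Hg.
  - intros m x. apply Hg.
Qed.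

(** By continuity [psi_m] stays in the window near [x], where [g] is a fixed complex multiple of the
    real function [F o psi_m]. *)
Lemma resolvent_Derive_n (mu : C) (G : nat -> R -> R) (F : R -> R) (g : R -> C) (m n : nat) :
  0 < Cmod mu -> jet G -> (forall x, G 0%nat x = Nat.iter m psi x) ->
  (forall x, 19 / 20 < Nat.iter m psi x < 21 / 20 ->
      g x = Cdiv (RtoC (F (Nat.iter m psi x))) (Cpow mu (S m))) ->
  forall x, Nat.iter m psi x = 1 ->
  Cmod (CDerive_n g n x) = Rabs (Derive_n (fun t => F (G 0%nat t)) n x) / Cmod mu ^ S m.
Proof.
  intros Hmu HG EG Hg x Hx.
  assert (Hloc : locally x (fun t => 19 / 20 < G 0%nat t < 21 / 20)).
  { assert (Hc : continuous (G 0%nat) x)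
      by (apply (ex_derive_continuous (G 0%nat)); eexists; apply HG).
    apply (Hc (fun y => 19 / 20 < y < 21 / 20)). rewrite EG, Hx.
    exists (mkposreal (1 / 20) ltac:(lra)). intros y Hy.
    assert (Hy' : Rabs (y - 1) < 1 / 20) by exact Hy. apply Rabs_lt_between in Hy'. lra. }
  set (z := Cinv (Cpow mu (S m))).
  assert (Eg : forall t, 19 / 20 < G 0%nat t < 21 / 20 ->
    g t = (F (G 0%nat t) * Re z, F (G 0%nat t) * Im z)).
  { intros t Ht. rewrite EG in *. rewrite Hg by assumption. unfold Cdiv. fold z.
    unfold Cmult, RtoC, Re, Im. simpl. f_equal; ring. }
  unfold CDerive_n.
  assert (E1 : Derive_n (fun t => Re (g t)) n x = Derive_n (fun t => F (G 0%nat t)) n x * Re z).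
  { rewrite <- Derive_n_scal_r. apply Derive_n_ext_loc.
    refine (filter_imp _ _ _ Hloc). intros t Ht. now rewrite Eg. }
  assert (E2 : Derive_n (fun t => Im (g t)) n x = Derive_n (fun t => F (G 0%nat t)) n x * Im z).
  { rewrite <- Derive_n_scal_r. apply Derive_n_ext_loc.
    refine (filter_imp _ _ _ Hloc). intros t Ht. now rewrite Eg. }
  rewrite E1, E2. set (d := Derive_n _ n x).
  replace (d * Re z, d * Im z) with (Cmult (RtoC d) z).
  2: { unfold Cmult, RtoC, Re, Im. simpl. f_equal; ring. }
  rewrite Cmod_mult, Cmod_R. unfold z. rewrite Cmod_inv.
  - rewrite Cmod_pow. reflexivity.
  - apply Cpow_nz. intros E. rewrite E, Cmod_0 in Hmu. lra.
Qed.

(** * The counterexample *)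

(** The surplus [p ^ ((g - e) p)] swallows the geometric factor [(B * D) ^ p]. *)
Lemma gevrey_absorb (W : nat -> R) (g e B D : R) :
  0 < D -> (forall p : nat, Rpower (INR p) (g * INR p) <= D ^ p * W p) -> e < g ->
  exists D', 0 < D' /\ forall p : nat, B ^ p * Rpower (INR p) (e * INR p) <= D' * W p.
Proof.
  intros HD HW He.
  destruct (geometric_le_factorial_power (B * D) (g - e)) as [D' [HD' H]]; [lra|].
  exists D'. split; [assumption|]. intros p.
  assert (HDp : 0 < D ^ p) by now apply pow_lt.
  apply Rmult_le_reg_l with (D ^ p); [assumption|].
  apply Rle_trans with ((B * D) ^ p * Rpower (INR p) (e * INR p)).
  { rewrite Rpow_mult_distr. apply Req_le. ring. }
  apply Rle_trans with (D' * Rpower (INR p) ((g - e) * INR p) * Rpower (INR p) (e * INR p)).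
  { apply Rmult_le_compat_r; [apply Rlt_le, Rpower_pos|apply H]. }
  rewrite Rmult_assoc, <- Rpower_plus.
  replace ((g - e) * INR p + e * INR p) with (g * INR p) by ring.
  specialize (HW p). nra.
Qed.

(** [preceq_seq] says nothing at [p = 0], hence the separate hypothesis there. *)
Lemma preceq_seq_pow (M N : nat -> R) :
  (forall p, 0 < M p) -> (forall p, 0 < N p) -> M 0%nat <= N 0%nat -> preceq_seq M N ->
  exists C, 0 < C /\ forall p, M p <= C ^ p * N p.
Proof.
  intros HM HN H0 [C HC]. exists (Rmax C 1).
  pose proof (Rmax_r C 1) as H1. split; [lra|]. intros [|p]; [simpl; lra|].
  assert (HMN : 0 < M (S p) / N (S p)) by (apply Rdiv_lt_0_compat; auto).
  assert (Hp : 0 < INR (S p)) by (apply lt_0_INR; lia).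
  assert (H : Rpower (M (S p) / N (S p)) (/ INR (S p)) <= Rmax C 1).
  { eapply Rle_trans; [|apply Rmax_l]. apply HC. exists (S p). split; [lia|reflexivity]. }
  assert (H' : M (S p) / N (S p) <= Rmax C 1 ^ S p).
  { replace (M (S p) / N (S p)) with
      (Rpower (M (S p) / N (S p)) (/ INR (S p)) ^ S p).
    - apply pow_incr. split; [apply Rlt_le, Rpower_pos|assumption].
    - rewrite <- Rpower_pow, Rpower_mult, Rinv_l, Rpower_1 by (try apply Rpower_pos; lra).
      reflexivity. }
  apply (Rmult_le_compat_r (N (S p))) in H'; [|apply Rlt_le, HN].
  unfold Rdiv in H'. rewrite Rmult_assoc, Rinv_l, Rmult_1_r in H'; [exact H'|].
  apply Rgt_not_eq, HN.
Qed.

(* Dividing by [n!^eps] places the sequence in the Beurling class; the factorial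
   makes its n-th roots unbounded, so that vertices are cofinal. *)
Definition target (T : nat -> R) (eps : R) (n : nat) : R :=
  T n / Rpower (INR (fact n)) eps + INR (fact n).

(** The division by [n! ^ eps] turns the geometric loss [(2 C) ^ p] into a constant; the summand
    [n!] is absorbed because [W] has Gevrey growth of order [g > 1]. The factor [2 ^ p] is reserved
    for the Leibniz rule. *)
Lemma target_bound (T W : nat -> R) (g eps C D : R) :
  0 < eps -> 0 < C -> 0 < D -> 1 < g -> (forall p, 0 < W p) ->
  (forall p, T p <= C ^ p * W p) ->
  (forall p : nat, Rpower (INR p) (g * INR p) <= D ^ p * W p) ->
  exists D', 0 < D' /\ forall p, 2 ^ p * target T eps p <= D' * W p.
Proof.
  intros He HC HD Hg HW HT HWg.
  destruct (gevrey_absorb W g 1 2 D HD HWg Hg) as [D1 [HD1 H1]].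
  destruct (geometric_le_factorial_power (2 * C * exp eps) eps He) as [D2 [HD2 H2]].
  exists (D1 + D2). split; [lra|]. intros p. unfold target.
  pose proof (Rpower_pos (INR (fact p)) eps) as HF.
  assert (HA : 2 ^ p * INR (fact p) <= D1 * W p).
  { eapply Rle_trans; [|apply H1]. apply Rmult_le_compat_l; [apply pow_le; lra|].
    rewrite <- (Rpower_1 (INR (fact p))) by apply INR_fact_lt_0.
    apply fact_Rpower_le. lra. }
  assert (HB : 2 ^ p * (T p / Rpower (INR (fact p)) eps) <= D2 * W p).
  { apply Rmult_le_reg_r with (Rpower (INR (fact p)) eps); [assumption|].
    replace (2 ^ p * (T p / Rpower (INR (fact p)) eps) * Rpower (INR (fact p)) eps)
      with (2 ^ p * T p) by (field; lra).
    apply Rle_trans with (2 ^ p * (C ^ p * W p)).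
    { apply Rmult_le_compat_l; [apply pow_le; lra|apply HT]. }
    assert (Hq : (2 * C) ^ p <= D2 * Rpower (INR (fact p)) eps).
    { pose proof (Rpower_le_fact eps p He) as H3. specialize (H2 p).
      rewrite (Rpow_mult_distr (2 * C)) in H2.
      assert (Hex : 0 < exp eps ^ p) by (apply pow_lt, exp_pos).
      apply Rmult_le_reg_r with (exp eps ^ p); [assumption|].
      eapply Rle_trans; [exact H2|].
      apply (Rmult_le_compat_l D2) in H3; [|lra]. lra. }
    rewrite <- Rmult_assoc, <- Rpow_mult_distr.
    apply (Rmult_le_compat_r (W p)) in Hq; [|apply Rlt_le, HW]. lra. }
  lra.
Qed.

(** On the support [(1 + |x|) ^ k <= 3 ^ k], and the bounds for [j] and for [k] combine through
    superadditivity of the logarithm of the weight sequence. *)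
Lemma S_weight_of_jet (sigma : R -> R) (F : nat -> R -> R) :
  W0 sigma -> jet F ->
  (forall x, x <= 19 / 20 \/ 21 / 20 <= x -> F 0%nat x = 0) ->
  (forall l, 0 < l -> exists K, forall j x, Rabs (F j x) <= K * weight_seq sigma l j) ->
  (forall l, 0 < l -> exists D, 0 < D /\ forall k, 3 ^ k <= D * weight_seq sigma l k) ->
  S_weight sigma (fun x => RtoC (F 0%nat x)).
Proof.
  intros Hw HF Hsupp HK HD.
  assert (Hz : jet (fun _ _ => 0)) by (intros n x; apply @is_derive_const).
  split.
  - intros n x. split.
    + exact (jet_ex_derive_n F HF n x).
    + exact (jet_ex_derive_n _ Hz n x).
  - intros l Hl. destruct (HK l Hl) as [K HKl]. destruct (HD l Hl) as [D [HD0 HDl]].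
    exists (K * D). intros r [x [j [k ->]]].
    assert (E : CDerive_n (fun x => RtoC (F 0%nat x)) j x = RtoC (F j x)).
    { unfold CDerive_n, RtoC. f_equal.
      - exact (jet_Derive_n F HF j x).
      - exact (jet_Derive_n _ Hz j x). }
    rewrite E, Cmod_R.
    pose proof (weight_seq_pos sigma l (j + k)) as HW.
    pose proof (weight_seq_pos sigma l j) as HWj.
    pose proof (weight_seq_pos sigma l k) as HWk.
    pose proof (weight_seq_superadd sigma l j k Hw Hl) as HS.
    assert (HK0 : 0 <= K).
    { pose proof (HKl j x). pose proof (Rabs_pos (F j x)).
      apply Rnot_lt_le; intros Hlt. nra. }
    apply Rmult_le_reg_r with (weight_seq sigma l (j + k)); [assumption|].
    unfold Rdiv. rewrite Rmult_assoc, Rinv_l, Rmult_1_r by lra.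
    destruct (Rle_dec (Rabs x) 2) as [Hx|Hx].
    + assert (H3 : (1 + Rabs x) ^ k <= D * weight_seq sigma l k).
      { eapply Rle_trans; [|apply HDl]. apply pow_incr. pose proof (Rabs_pos x). lra. }
      apply Rle_trans with (D * weight_seq sigma l k * (K * weight_seq sigma l j)).
      * apply Rmult_le_compat; [|apply Rabs_pos|assumption|apply HKl].
        apply pow_le. pose proof (Rabs_pos x). lra.
      * replace (D * weight_seq sigma l k * (K * weight_seq sigma l j))
          with (K * D * (weight_seq sigma l j * weight_seq sigma l k)) by ring.
        apply Rmult_le_compat_l; [nra|assumption].
    + assert (E0 : F j x = 0).
      { rewrite <- (jet_Derive_n F HF).
        rewrite (Derive_n_ext_loc (F 0%nat) (fun _ => 0)).
        - exact (jet_Derive_n _ Hz j x).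
        - exists (mkposreal (1 / 2) ltac:(lra)). intros y Hy.
          assert (Hy' : Rabs (y - x) < 1 / 2) by exact Hy. apply Rabs_lt_between in Hy'.
          apply Hsupp. unfold Rabs in Hx. destruct (Rcase_abs x); [left|right]; lra. }
      rewrite E0, Rabs_R0, Rmult_0_r. apply Rmult_le_pos; [nra|lra].
Qed.

(** The coefficients [b] are fixed before [F]: the signs that define [F] will be chosen in terms of
    them. *)
Lemma resolvent_leading (mu : C) (n : nat) :
  0 < Cmod mu ->
  exists b : nat -> R,
    ((INR n + 3) * (INR n + 4) / 12) ^ n <= b n /\
    forall (F : nat -> R -> R) (g : R -> C), jet F ->
      (forall x, 19 / 20 < Nat.iter n psi x < 21 / 20 ->
         g x = Cdiv (RtoC (F 0%nat (Nat.iter n psi x))) (Cpow mu (S n))) ->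
      Cmod (CDerive_n g n (back_orbit n))
      = Rabs (sum_f_R0 (fun j => b j * F j 1) n) / Cmod mu ^ S n.
Proof.
  intros Hmu. destruct (psi_iter_jet n) as [G [HG EG]].
  destruct (Derive_n_comp_expansion G n HG) as [b [_ [_ [Hbn Hb]]]].
  destruct (psi_iter_derive_back_orbit n) as [d [Hd Hge]].
  exists (fun j => b j (back_orbit n)). split.
  - rewrite Hbn.
    replace (G 1%nat (back_orbit n)) with d.
    + apply pow_incr. split; [|assumption]. pose proof (pos_INR n). nra.
    + rewrite <- (is_derive_unique _ _ _ Hd), <- (is_derive_unique _ _ _ (HG 0%nat _)).
      apply Derive_ext. intros t. now rewrite EG.
  - intros F g HF Hg.
    rewrite (resolvent_Derive_n mu G (F 0%nat) g n n Hmu HG EG Hg)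
      by apply psi_iter_back_orbit.
    rewrite (Hb F HF), EG, psi_iter_back_orbit. reflexivity.
Qed.

Lemma sum_f_R0_last (a : nat -> R) (n : nat) :
  (forall j, (j < n)%nat -> a j = 0) -> sum_f_R0 a n = a n.
Proof.
  intros H. destruct n as [|n]; [reflexivity|]. rewrite tech5.
  rewrite (sum_eq _ (fun _ => 0)) by (intros i Hi; apply H; lia).
  rewrite sum_cte. ring.
Qed.

(** Atoms with [k > n] vanish at 1 to order beyond [n], and atom [n] contributes only its leading
    term [P]. The [n]-th sum is therefore [A + s_n P] with [A] built from earlier signs, and
    [s_n A P >= 0] forces [|A + s_n P| >= |P|]. *)
Lemma signed_lincomb (u : nat -> nat -> R -> R) (b : nat -> nat -> R) (M : nat -> R) :
  lincomb_dominated u (fun k => (/ 2) ^ k) M ->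
  (forall k j, (j < k)%nat -> u k j 1 = 0) ->
  exists c : nat -> R, (forall k, Rabs (c k) = (/ 2) ^ k) /\
    forall n, Rabs (b n n * ((/ 2) ^ n * u n n 1))
              <= Rabs (sum_f_R0 (fun j => b n j * lincomb u c j 1) n).
Proof.
  intros Hdom Hu.
  set (r := fun n (c : nat -> R) => b n n * u n n 1 *
    sum_f_R0 (fun j => b n j *
    Series (fun k => if (k <? n)%nat then c k * (/ 2) ^ k * u k j 1 else 0)) n).
  destruct (sign_selection r) as [s Hs].
  { intros n c c' Hc. unfold r. f_equal. apply sum_eq. intros j _. f_equal.
    apply Series_ext. intros k. destruct (Nat.ltb_spec k n); [|reflexivity].
    now rewrite Hc. }
  assert (Hh : forall k, 0 < (/ 2) ^ k) by (intros k; apply pow_lt; lra).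
  exists (fun k => s k * (/ 2) ^ k). split.
  { intros k. rewrite Rabs_mult, (proj1 (Hs k)), Rabs_pos_eq by apply Rlt_le, Hh. ring. }
  intros n. destruct (Hs n) as [Hsn Hrn].
  set (A := sum_f_R0 (fun j => b n j *
    Series (fun k => if (k <? n)%nat then s k * (/ 2) ^ k * u k j 1 else 0)) n).
  assert (E : sum_f_R0 (fun j => b n j * lincomb u (fun k => s k * (/ 2) ^ k) j 1) n
    = A + s n * (b n n * ((/ 2) ^ n * u n n 1))).
  { rewrite (sum_eq _ (fun j => b n j *
      Series (fun k => if (k <? n)%nat then s k * (/ 2) ^ k * u k j 1 else 0)
      + b n j * (s n * (/ 2) ^ n * u n j 1))).
    - rewrite sum_plus, (sum_f_R0_last (fun j => b n j * (s n * (/ 2) ^ n * u n j 1))).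
      + unfold A. ring.
      + intros j Hj. rewrite Hu by assumption. ring.
    - intros j Hj. unfold lincomb. rewrite (Series_split_last _ n); [ring| |].
      + apply (lincomb_ex u (fun k => s k * (/ 2) ^ k) M).
        intros k i x. rewrite Rmult_assoc, Rabs_mult, (proj1 (Hs k)), Rmult_1_l. apply Hdom.
      + intros k Hk. rewrite Hu by lia. ring. }
  rewrite E. set (P := b n n * ((/ 2) ^ n * u n n 1)).
  assert (HAP : 0 <= s n * A * P).
  { unfold r in Hrn. fold A in Hrn. unfold P.
    replace (s n * A * (b n n * ((/ 2) ^ n * u n n 1)))
      with ((/ 2) ^ n * (s n * (b n n * u n n 1 * A))) by ring.
    apply Rmult_le_pos; [apply Rlt_le, Hh|assumption]. }
  assert (Hs2 : s n * s n = 1).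
  { destruct (Rle_dec 0 (s n)).
    - rewrite Rabs_pos_eq in Hsn by assumption. rewrite Hsn. ring.
    - rewrite Rabs_left in Hsn by lra. replace (s n) with (-1) by lra. ring. }
  apply Rsqr_le_abs_0. unfold Rsqr.
  replace ((A + s n * P) * (A + s n * P))
    with (A * A + 2 * (s n * A * P) + s n * s n * (P * P)) by ring.
  rewrite Hs2. nra.
Qed.

(** [n ^ (eps n)] dominates [(2 |q|) ^ n] up to a constant, and the spare [2 ^ n] eventually exceeds
    every constant. *)
Lemma large_index_contradiction (c x q eps : R) :
  0 < eps -> 0 < c ->
  ~ (forall n0 : nat, exists n, (n0 <= n)%nat /\
       c * Rpower (INR n) (eps * INR n) <= x * q ^ n).
Proof.
  intros He Hc H.
  destruct (geometric_le_factorial_power (2 * Rabs q) eps He) as [D [HD HDp]].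
  destruct (Pow_x_infinity 2) with (b := Rabs x * D / c + 1) as [n0 Hn0].
  { rewrite Rabs_pos_eq; lra. }
  destruct (H n0) as [n [Hn Hle]]. specialize (Hn0 n ltac:(lia)). specialize (HDp n).
  rewrite Rabs_pos_eq in Hn0 by (apply pow_le; lra). apply Rge_le in Hn0.
  rewrite Rpow_mult_distr, RPow_abs in HDp.
  set (P := Rpower (INR n) (eps * INR n)) in *. assert (HP : 0 < P) by apply Rpower_pos.
  assert (H1 : x * q ^ n <= Rabs x * Rabs (q ^ n)) by (rewrite <- Rabs_mult; apply Rle_abs).
  assert (H2 : 2 ^ n * (c * P) <= Rabs x * D * P).
  { apply Rle_trans with (2 ^ n * (Rabs x * Rabs (q ^ n))).
    - apply Rmult_le_compat_l; [apply pow_le; lra|lra].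
    - replace (2 ^ n * (Rabs x * Rabs (q ^ n))) with (Rabs x * (2 ^ n * Rabs (q ^ n))) by ring.
      rewrite Rmult_assoc. apply Rmult_le_compat_l; [apply Rabs_pos|assumption]. }
  assert (H3 : (Rabs x * D / c + 1) * (c * P) <= 2 ^ n * (c * P)).
  { apply Rmult_le_compat_r; [|assumption]. apply Rmult_le_pos; lra. }
  replace ((Rabs x * D / c + 1) * (c * P)) with (Rabs x * D * P + c * P) in H3
    by (field; lra).
  assert (0 < c * P) by now apply Rmult_lt_0_compat. lra.
Qed.

(** Dividing the frequency by [k] makes the highest frequency in the [k]-th power of the sine equal
    to [N]. *)
Definition atom (a : nat) (w N : R) (k : nat) (j : nat) (x : R) : R :=
  jet_mul (fun n x => w * sincos_jet (N / INR k) 1 n k 0 x) (cutoff_jet a) j 0 0 x.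

Lemma jet_scal_sincos (w b y : R) (k : nat) : jet (fun n x => w * sincos_jet b y n k 0 x).
Proof. intros n x. apply is_derive_scal, sincos_jet_derive. Qed.

Lemma jet_atom (a : nat) (w N : R) (k : nat) : (1 <= a)%nat -> jet (atom a w N k).
Proof.
  intros Ha. apply jet_jet_mul; [apply jet_scal_sincos|now apply jet_cutoff].
Qed.

Lemma freq_bound (N : R) (k : nat) :
  0 <= N -> 0 <= N / INR k /\ N / INR k * INR (k + 0) <= N.
Proof.
  intros HN. rewrite Nat.add_0_r. destruct k as [|k].
  (* For [k = 0] the convention [/ 0 = 0] makes the frequency 0. *)
  - simpl. unfold Rdiv. rewrite Rinv_0. lra.
  - assert (Hk : 0 < INR (S k)) by (apply lt_0_INR; lia). split.
    + apply Rmult_le_pos; [assumption|apply Rlt_le, Rinv_0_lt_compat, Hk].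
    + apply Req_le. field. lra.
Qed.

Lemma atom_bound (a : nat) (w N U : R) (k j : nat) (x : R) :
  0 <= w -> 0 <= N ->
  (forall i i', (i + i' = j)%nat -> w * N ^ i * Rabs (cutoff_jet a i' x) <= U) ->
  Rabs (atom a w N k j x) <= 2 ^ j * U.
Proof.
  intros Hw HN HU. apply (jet_mul_bound _ _ x U j); [|lia].
  intros i i' Hi. rewrite Rabs_mult, (Rabs_pos_eq w) by assumption.
  eapply Rle_trans; [|apply (HU i i' Hi)].
  apply Rmult_le_compat_r; [apply Rabs_pos|]. apply Rmult_le_compat_l; [assumption|].
  destruct (freq_bound N k HN) as [Hb1 Hb2].
  eapply Rle_trans; [apply sincos_jet_bound; exact Hb1|].
  apply pow_incr. split; [|exact Hb2]. apply Rmult_le_pos; [assumption|apply pos_INR].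
Qed.

Lemma atom_zero (a : nat) (w N : R) (k j : nat) : (j < k)%nat -> atom a w N k j 1 = 0.
Proof.
  intros Hj. apply (jet_mul_zero _ _ 1 k); [|lia].
  intros i Hi. rewrite sincos_jet_zero by assumption. ring.
Qed.

Lemma atom_leading (a : nat) (w N : R) (k : nat) :
  atom a w N k k 1 = w * (INR (fact k) * (N / INR k) ^ k) * cutoff_jet a 0 1.
Proof.
  unfold atom. rewrite (jet_mul_leading _ _ 1 k) by
    (try lia; intros i Hi; rewrite sincos_jet_zero by assumption; ring).
  now rewrite sincos_jet_leading.
Qed.

Lemma atom_support (a : nat) (w N : R) (k : nat) (x : R) :
  x <= 19 / 20 \/ 21 / 20 <= x -> atom a w N k 0 x = 0.
Proof. intros Hx. unfold atom, jet_mul. rewrite cutoff_support by assumption. ring. Qed.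

(** Dividing the frequency by [k] costs [k! / k ^ k >= e ^ (-k)], a geometric loss only. *)
Lemma fact_freq_lower (N : R) (k : nat) :
  0 <= N -> N ^ k <= exp 1 ^ k * (INR (fact k) * (N / INR k) ^ k).
Proof.
  intros HN. destruct k as [|k]; [simpl; lra|].
  assert (Hk : 0 < INR (S k)) by (apply lt_0_INR; lia).
  pose proof (pow_le_exp_fact (S k)) as H.
  replace (exp 1 ^ S k) with (exp (INR (S k))).
  2: { rewrite <- Rpower_pow by apply exp_pos. unfold Rpower. rewrite ln_exp. f_equal. ring. }
  unfold Rdiv. rewrite Rpow_mult_distr, pow_inv.
  set (m := INR (S k)) in *.
  assert (Hm : 0 < m ^ S k) by now apply pow_lt.
  apply Rmult_le_reg_r with (m ^ S k); [assumption|].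
  replace (exp m * (INR (fact (S k)) * (N ^ S k * / m ^ S k)) * m ^ S k)
    with (N ^ S k * (exp m * INR (fact (S k)))) by (field; lra).
  apply Rmult_le_compat_l; [now apply pow_le|assumption].
Qed.

Lemma exists_bad_resolvent (sigma : R -> R) (T : nat -> R) (alpha : R) (mu : C) :
  W0 sigma -> 0 < alpha < 2 -> 1 < Cmod mu -> Rbar_lt 1 (growth_index sigma) ->
  (forall p, 0 < T p) -> T 0%nat = 1 ->
  (forall l, 0 < l -> preceq_seq T (weight_seq sigma l)) ->
  exists f g : R -> C,
    S_weight sigma f /\ is_resolvent mu psi f g /\
    ~ bound (fun r => exists n x,
        r = Cmod (CDerive_n g n x) / (T n * Rpower (INR (fact n)) alpha)).
Proof.
  intros Hw Ha Hmu Hgi HT HT0 Hpre.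
  (* The gap is shared, [2 = alpha + eps + eps]: one [eps] pays for the division in [target], the
     other gives the final contradiction. *)
  set (eps := (2 - alpha) / 2). assert (Heps : 0 < eps) by (unfold eps; lra).
  destruct (weight_seq_gevrey sigma Hw Hgi) as [g0 [Hg0 Hgev]].
  (* A large [a] brings the Gevrey order [1 + 1 / a] of the cutoff below [g0]. *)
  destruct (INR_archimed (g0 - 1) 1 ltac:(lra)) as [a Haa].
  assert (Ha1 : (1 <= a)%nat) by (destruct a; [simpl in Haa; lra|lia]).
  assert (HaR : 0 < INR a) by (apply lt_0_INR; lia).
  assert (He : 1 + / INR a < g0).
  { assert (/ INR a < g0 - 1); [|lra]. apply Rmult_lt_reg_l with (INR a); [assumption|].
    rewrite Rinv_r by lra. lra. }
  destruct (cutoff_bound a Ha1) as [Bc [HBc Hcut]].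
  set (V := target T eps).
  assert (HVf : forall n, INR (fact n) <= V n).
  { intros n. unfold V, target.
    assert (0 < T n / Rpower (INR (fact n)) eps)
      by (apply Rdiv_lt_0_compat; [apply HT|apply Rpower_pos]). lra. }
  assert (HVT : forall n, T n <= V n * Rpower (INR (fact n)) eps).
  { intros n. unfold V, target. pose proof (Rpower_pos (INR (fact n)) eps).
    pose proof (INR_fact_lt_0 n).
    rewrite Rmult_plus_distr_r. unfold Rdiv. rewrite Rmult_assoc, Rinv_l, Rmult_1_r by lra.
    nra. }
  assert (HV0 : forall n, 0 < V n).
  { intros n. eapply Rlt_le_trans; [apply INR_fact_lt_0|apply HVf]. }
  destruct (choice_fun (fun k (wN : R * R) => 0 <= fst wN /\ 0 <= snd wN /\
      (forall j, fst wN * snd wN ^ j <= V j) /\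
      ((exists N, vertex V k N) -> fst wN * snd wN ^ k = V k))) as [wN HwN].
  { intros k. destruct (classic (exists N, vertex V k N)) as [[N [HN Hv]]|Hno].
    - exists (V k / N ^ k, N). simpl. repeat split.
      + apply Rlt_le, Rdiv_lt_0_compat; [apply HV0|now apply pow_lt].
      + lra.
      + exact Hv.
      + intros _. field. apply Rgt_not_eq. now apply pow_lt.
    (* At an index that is not a vertex the atom is taken to be zero. *)
    - exists (0, 0). simpl. repeat split; try lra.
      + intros j. rewrite Rmult_0_l. apply Rlt_le, HV0.
      + intros H. contradiction. }
  set (u := fun k => atom a (fst (wN k)) (snd (wN k)) k).
  assert (Hdom : forall l, 0 < l -> exists K,
    lincomb_dominated u (fun k => (/ 2) ^ k) (fun j => K * weight_seq sigma l j)).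
  { intros l Hl. destruct (Hgev l Hl) as [D [HD HDp]].
    destruct (preceq_seq_pow T (weight_seq sigma l) HT (weight_seq_pos sigma l)) as [C [HC HCp]].
    { rewrite HT0, weight_seq_0 by assumption. lra. }
    { now apply Hpre. }
    destruct (target_bound T (weight_seq sigma l) g0 eps C D) as [D1 [HD1 H1]];
      try assumption; [apply weight_seq_pos|].
    destruct (gevrey_absorb (weight_seq sigma l) g0 (1 + / INR a) (2 * Bc) D HD HDp He)
      as [D2 [HD2 H2]].
    exists (D1 * D2). intros k j x.
    assert (Hh : 0 < (/ 2) ^ k) by (apply pow_lt; lra).
    rewrite Rabs_mult, (Rabs_pos_eq ((/ 2) ^ k)), Rmult_comm by lra.
    apply Rmult_le_compat_r; [lra|].
    destruct (HwN k) as [Hw1 [Hw2 [Hw3 _]]].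
    set (W := weight_seq sigma l) in *.
    (* The division by [2 ^ j] offsets the Leibniz factor of [atom_bound]. It is paid back as
       [2 ^ i * 2 ^ i'], one part absorbed with [V] in [H1], the other with the cutoff in [H2]. *)
    replace (D1 * D2 * W j) with (2 ^ j * (D1 * D2 * W j / 2 ^ j))
      by (field; apply Rgt_not_eq, pow_lt; lra).
    apply atom_bound; try assumption. intros i i' Hij.
    assert (H2j : 0 < 2 ^ j) by (apply pow_lt; lra).
    apply Rmult_le_reg_l with (2 ^ j); [assumption|].
    replace (2 ^ j * (D1 * D2 * W j / 2 ^ j)) with (D1 * D2 * W j) by (field; lra).
    apply Rle_trans with ((D1 * W i) * (D2 * W i')).
    - rewrite <- Hij, pow_add.
      replace (2 ^ i * 2 ^ i' * (fst (wN k) * snd (wN k) ^ i * Rabs (cutoff_jet a i' x)))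
        with ((2 ^ i * (fst (wN k) * snd (wN k) ^ i)) * (2 ^ i' * Rabs (cutoff_jet a i' x)))
        by ring.
      apply Rmult_le_compat.
      + apply Rmult_le_pos; [apply pow_le; lra|].
        apply Rmult_le_pos; [assumption|now apply pow_le].
      + apply Rmult_le_pos; [apply pow_le; lra|apply Rabs_pos].
      + eapply Rle_trans; [|apply H1]. apply Rmult_le_compat_l; [apply pow_le; lra|apply Hw3].
      + eapply Rle_trans; [|apply H2]. rewrite Rpow_mult_distr, Rmult_assoc.
        apply Rmult_le_compat_l; [apply pow_le; lra|apply Hcut].
    - replace (D1 * W i * (D2 * W i')) with (D1 * D2 * (W i * W i')) by ring.
      apply Rmult_le_compat_l; [nra|]. rewrite <- Hij. now apply weight_seq_superadd. }
  assert (Hujet : forall k, jet (u k)) by (intros k; now apply jet_atom).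
  destruct (choice_fun _ (fun n => resolvent_leading mu n ltac:(lra))) as [b Hb].
  (* Convergence, and hence the choice of signs, requires a single [l]; the domination for every
     other [l] passes to [c] because [|c k| = 2 ^ (-k)]. *)
  destruct (Hdom 1 ltac:(lra)) as [K1 Hdom1].
  destruct (signed_lincomb u b _ Hdom1) as [c [Hc Hlow]].
  { intros k j Hj. now apply atom_zero. }
  assert (Hdomc : forall M, lincomb_dominated u (fun k => (/ 2) ^ k) M -> lincomb_dominated u c M).
  { intros M HM k j x. specialize (HM k j x). rewrite Rabs_mult in *.
    rewrite Hc. rewrite (Rabs_pos_eq ((/ 2) ^ k)) in HM by (apply pow_le; lra). exact HM. }
  set (F := lincomb u c).
  assert (HF : jet F) by exact (lincomb_jet u c _ Hujet (Hdomc _ Hdom1)).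
  assert (HF0 : forall x, x <= 19 / 20 \/ 21 / 20 <= x -> F 0%nat x = 0).
  { intros x Hx. unfold F, lincomb. rewrite (Series_ext _ (fun k => 0 * 0)).
    - rewrite Series_scal_l. ring.
    - intros k. unfold u. rewrite atom_support by assumption. ring. }
  destruct (resolvent_exists mu (F 0%nat) HF0) as [g [Hres Hg]].
  exists (fun x => RtoC (F 0%nat x)), g. split; [|split; [exact Hres|]].
  { apply S_weight_of_jet; try assumption.
    - intros l Hl. destruct (Hdom l Hl) as [K HK]. exists (2 * K). intros j x.
      eapply Rle_trans; [apply (lincomb_bound u c _ j x (Hdomc _ HK))|]. apply Req_le; ring.
    - intros l Hl. destruct (Hgev l Hl) as [D [HD HDp]].
      destruct (gevrey_absorb (weight_seq sigma l) g0 0 3 D HD HDp ltac:(lra)) as [D' [HD' H']].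
      exists D'. split; [assumption|]. intros k. eapply Rle_trans; [|apply H'].
      rewrite Rmult_0_l. unfold Rpower. rewrite Rmult_0_l, exp_0. lra. }
  intros [B HB].
  set (chi := cutoff_jet a 0 1). assert (Hchi : 0 < chi) by apply cutoff_1_pos.
  set (M := Cmod mu) in *.
  (* In the base, [M] comes from [mu ^ (n + 1)], 12 from the bound on the derivative of [psi_n], 2
     from the coefficient of the atom and [exp 1] from its frequency. *)
  apply (large_index_contradiction chi (B * M) (M * (24 * exp 1)) eps Heps Hchi).
  (* The successor keeps [n] positive. *)
  intros n0. destruct (vertex_cofinal V HVf (S n0)) as [n [N [Hn Hv]]].
  exists n. split; [lia|].
  destruct (HwN n) as [Hw1 [Hw2 [_ Hw4]]]. specialize (Hw4 (ex_intro _ N Hv)).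
  destruct (Hb n) as [Hbn Hbg]. specialize (Hbg F g HF (Hg n)).
  specialize (HB _ (ex_intro _ n (ex_intro _ (back_orbit n) eq_refl))).
  rewrite Hbg in HB. specialize (Hlow n). fold F in Hlow.
  unfold u in Hlow. rewrite atom_leading in Hlow. fold chi in Hlow.
  set (w := fst (wN n)) in *. set (N' := snd (wN n)) in *.
  pose proof (fact_freq_lower N' n Hw2) as Hff.
  set (Q := INR (fact n) * (N' / INR n) ^ n) in *.
  assert (Hnpos : 1 <= INR n) by (change 1 with (INR 1); apply le_INR; lia).
  assert (HMn : 0 < M ^ S n) by (apply pow_lt; lra).
  assert (He1 : 0 < exp 1 ^ n) by (apply pow_lt, exp_pos).
  pose proof (HT n) as HTn. pose proof (Rpower_pos (INR (fact n)) alpha) as HFa.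
  pose proof (Rpower_pos (INR (fact n)) eps) as HFe.
  set (Fa := Rpower (INR (fact n)) alpha) in *. set (Fe := Rpower (INR (fact n)) eps) in *.
  set (Sg := Rabs (sum_f_R0 _ n)) in *.
  assert (HS : Sg <= B * M ^ S n * (T n * Fa)).
  { assert (HTF : 0 < T n * Fa) by now apply Rmult_lt_0_compat.
    apply (Rmult_le_compat_r (M ^ S n * (T n * Fa))) in HB;
      [|apply Rlt_le; now apply Rmult_lt_0_compat].
    replace (Sg / M ^ S n / (T n * Fa) * (M ^ S n * (T n * Fa))) with Sg in HB
      by (field; repeat split; lra).
    lra. }
  assert (HwQ : T n <= Fe * exp 1 ^ n * (w * Q)).
  { apply (Rmult_le_compat_l w) in Hff; [|assumption]. rewrite Hw4 in Hff.
    specialize (HVT n). fold Fe in HVT.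
    apply (Rmult_le_compat_r Fe) in Hff; [|lra]. nra. }
  assert (HwQ0 : 0 < w * Q).
  { assert (0 < Fe * exp 1 ^ n) by now apply Rmult_lt_0_compat.
    apply Rnot_le_lt. intros Hle. nra. }
  assert (Hpw : Rpower (INR n) (2 * INR n) <= 12 ^ n * b n n).
  { apply Rle_trans with (12 ^ n * ((INR n + 3) * (INR n + 4) / 12) ^ n).
    - rewrite <- Rpow_mult_distr, (Rmult_comm 2), <- Rpower_mult, Rpower_pow by lra.
      replace (Rpower (INR n ^ n) 2) with ((INR n ^ 2) ^ n).
      + apply pow_incr. split; [apply pow2_ge_0|]. nra.
      + change 2 with (INR 2). rewrite Rpower_pow by (apply pow_lt; lra).
        rewrite <- !pow_mult. f_equal. lia.
    - apply Rmult_le_compat_l; [apply pow_le; lra|assumption]. }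
  assert (Hb0 : 0 < b n n).
  { pose proof (Rpower_pos (INR n) (2 * INR n)).
    assert (0 < 12 ^ n) by (apply pow_lt; lra). apply Rnot_le_lt. intros Hle. nra. }
  assert (Hh : 0 < (/ 2) ^ n) by (apply pow_lt; lra).
  assert (Hlow' : b n n * ((/ 2) ^ n * (w * Q * chi)) <= B * M ^ S n * (T n * Fa)).
  { eapply Rle_trans; [|exact HS]. eapply Rle_trans; [|exact Hlow].
    apply Rle_abs. }
  assert (H24 : (24 * exp 1) ^ n = 12 ^ n * 2 ^ n * exp 1 ^ n).
  { rewrite <- !Rpow_mult_distr. f_equal. ring. }
  assert (H22 : 2 ^ n * (/ 2) ^ n = 1).
  { rewrite <- Rpow_mult_distr. replace (2 * / 2) with 1 by field. apply pow1. }
  assert (HB0 : 0 <= B).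
  { apply Rnot_lt_le. intros Hlt.
    assert (0 < b n n * ((/ 2) ^ n * (w * Q * chi))).
    { apply Rmult_lt_0_compat; [assumption|].
      apply Rmult_lt_0_compat; [assumption|now apply Rmult_lt_0_compat]. }
    assert (0 < M ^ S n * (T n * Fa)) by (apply Rmult_lt_0_compat; [assumption|now apply Rmult_lt_0_compat]).
    nra. }
  (* After cancelling [T n], what remains is [n^(2n) <= const^n n!^(alpha + eps)]. *)
  assert (Hmain : chi * Rpower (INR n) (2 * INR n)
     <= B * M * (M * (24 * exp 1)) ^ n * (Fa * Fe)).
  { apply Rmult_le_reg_r with (w * Q); [assumption|].
    apply Rle_trans with (12 ^ n * 2 ^ n * (b n n * ((/ 2) ^ n * (w * Q * chi)))).
    - replace (12 ^ n * 2 ^ n * (b n n * ((/ 2) ^ n * (w * Q * chi))))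
        with (chi * (12 ^ n * b n n) * (w * Q) * (2 ^ n * (/ 2) ^ n)) by ring.
      rewrite H22, Rmult_1_r. apply Rmult_le_compat_r; [lra|].
      apply Rmult_le_compat_l; [lra|assumption].
    - apply Rle_trans with (12 ^ n * 2 ^ n * (B * M ^ S n * (T n * Fa))).
      + apply Rmult_le_compat_l; [|assumption].
        apply Rmult_le_pos; apply pow_le; lra.
      + apply Rle_trans with
          (12 ^ n * 2 ^ n * (B * M ^ S n * (Fe * exp 1 ^ n * (w * Q) * Fa))).
        * apply Rmult_le_compat_l; [apply Rmult_le_pos; apply pow_le; lra|].
          apply Rmult_le_compat_l; [apply Rmult_le_pos; lra|].
          apply Rmult_le_compat_r; lra.
        * apply Req_le. rewrite (Rpow_mult_distr M), H24. simpl (M ^ S n). ring. }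
  assert (HFF : Fa * Fe <= Rpower (INR n) ((alpha + eps) * INR n)).
  { unfold Fa, Fe. rewrite <- Rpower_plus. apply fact_Rpower_le. lra. }
  assert (H2n : Rpower (INR n) (2 * INR n)
    = Rpower (INR n) (eps * INR n) * Rpower (INR n) ((alpha + eps) * INR n)).
  { rewrite <- Rpower_plus. f_equal. unfold eps. field. }
  pose proof (Rpower_pos (INR n) ((alpha + eps) * INR n)) as HR.
  apply Rmult_le_reg_r with (Rpower (INR n) ((alpha + eps) * INR n)); [assumption|].
  rewrite Rmult_assoc, <- H2n. eapply Rle_trans; [exact Hmain|].
  apply Rmult_le_compat_l; [|assumption].
  apply Rmult_le_pos; [apply Rmult_le_pos; lra|]. apply pow_le.
  pose proof (exp_pos 1). nra.
Qed.

Theorem theorem4p1 :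
  forall (sigma tau : R -> R) (alpha : R) (mu : C),
    W0 sigma -> W0 tau ->
    0 < alpha < 2 ->
    1 < Cmod mu ->
    Rbar_lt 1 (growth_index sigma) ->
    (exists k0, 0 < k0 /\
       forall l, 0 < l -> preceq_seq (weight_seq tau k0) (weight_seq sigma l)) ->
    (exists f g : R -> C,
       S_weight sigma f /\
       is_resolvent mu psi f g /\
       ~ S_weight (pow_arg (lower_star (pow_arg (inv_arg tau) alpha)) (1 / alpha)) g) /\
    (forall h : R -> C,
       S_weight (pow_arg (lower_star (pow_arg (inv_arg tau) alpha)) (1 / alpha)) h <->
       S_weight (check_star tau (id_pow (1 / alpha))) h) /\
    (forall h : R -> C,
       S_weight (check_star tau (id_pow (1 / alpha))) h <->
       S_family (mul_gevrey (weight_seq tau) alpha) h).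
Proof.
  intros sigma tau alpha mu Hs Ht Ha Hmu Hg [k0 [Hk0 Hpre]].
  rewrite lower_star_eq_check_star by lra.
  split; [|split].
  - destruct (exists_bad_resolvent sigma (weight_seq tau k0) alpha mu Hs Ha Hmu Hg
      (weight_seq_pos tau k0) (weight_seq_0 tau k0 Ht) Hpre) as [f [g [Hf [Hr Hn]]]].
    exists f, g. split; [assumption|]. split; [assumption|].
    rewrite S_weight_check_star_iff by (try assumption; lra).
    (* Membership would bound the quotients for index [k0], [h = 1] and no polynomial weight, which
       is what the construction excludes. *)
    intros [_ H]. apply Hn. destruct (H k0 1 Hk0 ltac:(lra)) as [B HB].
    exists B. intros r [n [x ->]]. apply HB. exists x, n, 0%nat.
    rewrite Nat.add_0_r, pow1. unfold mul_gevrey. simpl pow. now rewrite !Rmult_1_l.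
  - tauto.
  - intros h. apply S_weight_check_star_iff; [assumption|lra].
Qed.
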